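(* (1) There exists a Dedekind domain $A$ having an overring that is well-centered on $A$ but is not a localization of $A$. (2) There exists a Dedekind domain $A$ having an overring that is almost well-centered on $A$ but is not well-centered on $A$. Moreover, in each of the cases (1) and (2) the Dedekind domain $A$ can be chosen so that $A$ has exactly two overrings that are almost well-centered on $A$ and are not localizations of $A$, and these two overrings are also exactly the overrings $D\neq A$ of $A$ that are almost well-centered on $A$ and satisfy $\mathcal U(D)\cap A=\mathcal U(A)$.
   Context: For an integral domain $A$ with field of fractions $K$, an overring of $A$ is a subring $D$ of $K$ with $A\subseteq D$. $\mathcal U(R)$ is the unit group of a ring $R$. $D$ is well-centered on $A$ if for each $d\in D$ there is $u\in\mathcal U(D)$ with $ud\in A$; $D$ is almost well-centered on $A$ if for each $d\in D$ there are a positive integer $n$ and $u\in\mathcal U(D)$ with $ud^n\in A$. $D$ is a localization of $A$ if $D=S^{-1}A$ for some multiplicatively closed set $S$ of nonzero elements of $A$. *)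

(* Defs.v *)
From mathcomp Require Import all_boot all_algebra.
Set Implicit Arguments. Unset Strict Implicit. Unset Printing Implicit Defensive.
Import GRing.Theory.
Local Open Scope ring_scope.

Section Defs.
Variable K : fieldType.
Implicit Types (A D I J S : K -> Prop).

Definition seteq D E := forall x, D x <-> E x.

Definition is_subring D :=
  [/\ D 0, D 1, (forall x y, D x -> D y -> D (x - y)) & (forall x y, D x -> D y -> D (x * y))].

Definition is_frac_field A :=
  forall x : K, exists a b, [/\ A a, A b, b != 0 & x = a / b].

Definition unit_of D (x : K) := D x /\ exists y, D y /\ x * y = 1.

Definition ideal A I :=
  [/\ (forall x, I x -> A x), I 0, (forall x y, I x -> I y -> I (x + y))
    & (forall a x, A a -> I x -> I (a * x))].

Definition fin_gen A I :=
  exists s : seq K, (forall i, (i < size s)%N -> I s`_i) /\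
    forall x, I x -> exists c : seq K, [/\ size c = size s, (forall i, A c`_i)
       & x = \sum_(i < size s) c`_i * s`_i].

Definition noetherian A := forall I, ideal A I -> fin_gen A I.

Definition prime_ideal A I :=
  [/\ ideal A I, ~ I 1 & forall a b, A a -> A b -> I (a * b) -> I a \/ I b].

Definition maximal_ideal A I :=
  [/\ ideal A I, ~ I 1 &
      forall J, ideal A J -> (forall x, I x -> J x) -> J 1 \/ seteq J I].

Definition integrally_closed A :=
  forall x : K, (exists p : {poly K}, [/\ p \is monic, (forall i, A p`_i) & root p x]) -> A x.

Definition dedekind A :=
  [/\ noetherian A, integrally_closed A &
      forall P, prime_ideal A P -> (exists x, P x /\ x != 0) -> maximal_ideal A P].

Definition overring A D := is_subring D /\ forall x, A x -> D x.

Definition well_centered A D :=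
  forall d, D d -> exists u, unit_of D u /\ A (u * d).

Definition almost_well_centered A D :=
  forall d, D d -> exists n : nat, (0 < n)%N /\ exists u, unit_of D u /\ A (u * d ^+ n).

Definition localization_of A D :=
  exists S, [/\ (forall s, S s -> A s /\ s != 0), S 1,
     (forall s t, S s -> S t -> S (s * t)) &
     seteq D (fun x => exists a s, [/\ A a, S s & x = a / s])].

Definition two_awc_property A :=
  exists D1 D2, [/\ overring A D1, overring A D2, ~ seteq D1 D2,
    (forall D, overring A D ->
       (almost_well_centered A D /\ ~ localization_of A D) <-> (seteq D D1 \/ seteq D D2))
  & (forall D, overring A D ->
       ([/\ ~ seteq D A, almost_well_centered A D &
            forall x, (unit_of D x /\ A x) <-> unit_of A x])
       <-> (seteq D D1 \/ seteq D D2))].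

End Defs.

(* Main.v *)
(* A single domain serves both parts.  Suppose a family of discrete valuations v_i of a
   field K carries weights c_i such that the divisors of elements of K are exactly the
   finitely supported integer functions of degree sum c_i n_i = 0.  If the residue fields
   are algebraic over finite fields, the ring A of elements with all v_i >= 0 is a Dedekind
   domain with class group Z, its overrings are obtained by inverting sets Delta of places,
   and a degree count shows that such an overring is almost well-centered without being a
   localization precisely when Delta is the set of all places of positive weight, or the
   set of all places of negative weight.  With weights 2, 3, -1 and -4, inverting the
   negative places gives a well-centered overring, since -1 generates; inverting the
   positive ones does not, since 1 is not a sum of 2's and 3's.

   Such valuations are built on K = Frac Z[X]: each prime p_n carries four p_n-adic
   integers alpha_(n, i), and v_(n, i) f is the p_n-adic valuation of f (alpha_(n, i)).  The
   primes and the alpha are chosen by successive approximation.  As the weights sum to 0,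
   constants have degree 0; each irreducible f in turn is made of degree 0 by letting it
   vanish to suitable orders at two new primes, all later primes avoiding it; linear
   polynomials found by Chinese remaindering provide the principal divisors. *)

Require Import Defs.
From Stdlib Require Import Classical ClassicalEpsilon FunctionalExtensionality
  PropExtensionality.
From mathcomp Require Import all_boot all_order all_algebra cyclic zify ring.
Set Implicit Arguments. Unset Strict Implicit. Unset Printing Implicit Defensive.
Import Order.TTheory GRing.Theory Num.Theory.
Local Open Scope ring_scope.

(** * The Dedekind domain of a degree on places *)

Lemma pred_ext (T : Type) (P Q : T -> Prop) : (forall x, P x <-> Q x) -> P = Q.
Proof.
move=> PQ; apply: functional_extensionality => x.
exact: propositional_extensionality.
Qed.

(** Both sides reduce to the sum over the indices common to [S] and [T]. *)
Lemma sum_support (I : eqType) (F : I -> int) (S T : seq I) :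
  uniq S -> uniq T ->
  (forall i, i \notin S -> F i = 0) -> (forall i, i \notin T -> F i = 0) ->
  \sum_(i <- S) F i = \sum_(i <- T) F i.
Proof.
move=> uS uT FS FT.
have aux (A B : seq I) : (forall i, i \notin B -> F i = 0) ->
    \sum_(i <- A) F i = \sum_(i <- [seq i <- A | i \in B]) F i.
  move=> FB; rewrite big_filter [LHS](bigID (mem B)) /=.
  by rewrite [X in _ + X = _]big1 ?addr0 // => i /FB.
rewrite (aux S T) // (aux T S) //; apply: perm_big; apply: uniq_perm.
- exact: filter_uniq.
- exact: filter_uniq.
- by move=> i; rewrite !mem_filter andbC.
Qed.

(** The disjunct [x == 0] stands for an infinite valuation at 0, since [v] takes values in [int]. *)
Definition val_ge (K : fieldType) (I : Type) (v : I -> K -> int) i (m : int) (x : K) :=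
  (x == 0) || (m <= v i x).

(** [residue_torsion] makes every nonzero residue class a root of unity. [degree0] and [principal]
    together describe the principal divisors. Classes 2 and -1 occur outside every finite set, which
    leaves room for correcting degrees. *)
Record divisor_theory (K : fieldType) (I : eqType) (v : I -> K -> int)
    (c : I -> int) : Prop := DivisorTheory {
  valM : forall i x y, x != 0 -> y != 0 -> v i (x * y) = v i x + v i y;
  valD : forall i m x y, val_ge v i m x -> val_ge v i m y -> val_ge v i m (x + y);
  residue_torsion : forall i x, x != 0 -> v i x = 0 ->
    exists n, val_ge v i 1 (x ^+ n.+1 - 1);
  degree0 : forall x, x != 0 -> exists S, [/\ uniq S,
    (forall i, i \notin S -> v i x = 0) & \sum_(i <- S) c i * v i x = 0];
  principal : forall S n, uniq S -> \sum_(i <- S) c i * n i = 0 ->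
    exists2 x, x != 0 & forall i, v i x = if i \in S then n i else 0;
  class_two : forall S : seq I, exists2 i, i \notin S & c i = 2;
  class_opp1 : forall S : seq I, exists2 i, i \notin S & c i = -1;
  class_neq0 : forall i, c i != 0 }.

Section DivisorTheory.
Variables (K : fieldType) (I : eqType) (v : I -> K -> int) (c : I -> int).
Hypothesis dt : divisor_theory v c.
Local Notation vge := (val_ge v).

(** The intersection of the valuation rings at the places outside [Delta]. *)
Definition inverting (Delta : I -> Prop) (x : K) := forall i, ~ Delta i -> vge i 0 x.
Definition integer := inverting (fun=> False).
Local Notation A := integer.

Lemma vgeE i m x : x != 0 -> vge i m x = (m <= v i x).
Proof. by rewrite /val_ge => /negPf->. Qed.

Lemma vge0 i m : vge i m 0. Proof. by rewrite /val_ge eqxx. Qed.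

Lemma integerP x : A x <-> forall i, vge i 0 x.
Proof. by split=> H i; [apply: H | move=> _]. Qed.

Lemma val1 i : v i 1 = 0.
Proof. by have := valM dt i (oner_neq0 K) (oner_neq0 K);
  rewrite mulr1 -{1}[v i 1]addr0 => /addrI. Qed.

Lemma valV i x : x != 0 -> v i x^-1 = - v i x.
Proof.
move=> x0; have x'0 : x^-1 != 0 by rewrite invr_eq0.
have := valM dt i x0 x'0; rewrite mulfV // val1; lia.
Qed.

Lemma valX i x n : x != 0 -> v i (x ^+ n) = v i x *+ n.
Proof.
move=> x0; elim: n => [|n IHn]; first by rewrite expr0 val1.
by rewrite exprS (valM dt) ?expf_neq0 // IHn mulrS.
Qed.

Lemma valN1 i : v i (-1) = 0.
Proof.
have N0 : -1 != 0 :> K by rewrite oppr_eq0 oner_neq0.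
have := valM dt i N0 N0; rewrite mulrNN mulr1 val1; lia.
Qed.

Lemma vgeM i m n x y : vge i m x -> vge i n y -> vge i (m + n) (x * y).
Proof.
rewrite /val_ge mulf_eq0; have [//|x0] := eqVneq x 0; have [//|y0] := eqVneq y 0.
by rewrite /= (valM dt) //; lia.
Qed.

Lemma vge1 i : vge i 0 1.
Proof. by rewrite vgeE ?oner_neq0 // val1. Qed.

Lemma vgeN i m x : vge i m x -> vge i m (- x).
Proof.
move=> mx; rewrite -[m]add0r -mulN1r; apply: vgeM mx.
by rewrite vgeE ?oppr_eq0 ?oner_neq0 // valN1.
Qed.

Lemma vgeB i m x y : vge i m x -> vge i m y -> vge i m (x - y).
Proof. by move=> mx /vgeN; apply: valD dt _ _ _ _ mx. Qed.

Lemma inverting_subring Delta : is_subring (inverting Delta).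
Proof.
split=> [i _|i _|x y Dx Dy i Di|x y Dx Dy i Di].
- exact: vge0.
- exact: vge1.
- by apply: vgeB; [apply: Dx | apply: Dy].
- by rewrite -[0](addr0 0); apply: vgeM; [apply: Dx | apply: Dy].
Qed.

Lemma inverting_overring Delta : overring A (inverting Delta).
Proof. by split=> [|x Ax i _]; [apply: inverting_subring | apply: Ax]. Qed.

Lemma integerM x y : A x -> A y -> A (x * y).
Proof. by have [_ _ _] := inverting_subring (fun=> False); apply. Qed.

Lemma integerB x y : A x -> A y -> A (x - y).
Proof. by have [_ _ + _] := inverting_subring (fun=> False); apply. Qed.

Lemma integer0 : A 0. Proof. by have [] := inverting_subring (fun=> False). Qed.
Lemma integer1 : A 1. Proof. by have [] := inverting_subring (fun=> False). Qed.

Lemma supportP x : x != 0 ->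
  exists2 S, uniq S & forall i, i \notin S -> v i x = 0.
Proof. by move=> /(degree0 dt)[S [uS xS _]]; exists S. Qed.

Lemma degree0_sum S x : x != 0 -> uniq S -> (forall i, i \notin S -> v i x = 0) ->
  \sum_(i <- S) c i * v i x = 0.
Proof.
move=> x0 uS xS; have [T [uT xT sumT]] := degree0 dt x0.
apply: etrans sumT; apply: (@sum_support _ (fun i => c i * v i x)) => // i.
  by move=> /xS->; rewrite mulr0.
by move=> /xT->; rewrite mulr0.
Qed.

(** The degree multiplied by [e] is a sum of nonnegative terms equal to 0, so every term
    vanishes. *)
Lemma degree0_one_sided e x : e != 0 -> x != 0 ->
  (forall i, 0 <= e * c i * v i x) -> forall i, v i x = 0.
Proof.
move=> e0 x0 xge i; have [S [uS xS sumS]] := degree0 dt x0.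
have [iS|/xS//] := boolP (i \in S).
have : \sum_(j <- S) e * c j * v j x == 0.
  by under eq_bigr do rewrite -mulrA; rewrite -mulr_sumr sumS mulr0.
rewrite psumr_eq0 // => /allP/(_ i iS) /=.
by rewrite !mulf_eq0 (negPf e0) (negPf (class_neq0 dt i)) => /eqP.
Qed.

(** The degree of the prescribed values is compensated at two places outside [S], of classes 2 and
    -1, with nonnegative multiplicities. *)
Lemma approximation S n : uniq S -> exists x, [/\ x != 0,
  (forall i, i \in S -> v i x = n i) & forall i, i \notin S -> 0 <= v i x].
Proof.
move=> uS; set s := \sum_(i <- S) c i * n i.
have [a aS ca] := class_two dt S; have [b bS cb] := class_opp1 dt (a :: S).
move: bS; rewrite inE negb_or => /andP[ba bS].
(* The multiplicities satisfy [s + 2 * |s| - (s + 2 * |s|) = 0], and [s + 2 * |s|] is nonnegative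
   for either sign of [s]. *)
pose m i := if i \in S then n i else if i == a then `|s| else s + 2 * `|s|.
have [||x x0 vx] := @principal _ _ _ _ dt [:: b, a & S] m.
- by rewrite /= inE negb_or ba bS aS.
- rewrite !big_cons {1 2}/m (negPf aS) (negPf bS) (negPf ba) eqxx ca cb.
  have -> : \sum_(j <- S) c j * m j = s.
    by apply: eq_big_seq => i iS; rewrite /m iS.
  lia.
exists x; split=> // i iS; rewrite vx !inE; first by rewrite iS !orbT /m iS.
by rewrite (negPf iS) orbF /m (negPf iS); do ![case: eqVneq => _ //=]; lia.
Qed.

(** The quotient [x / y] is regular at [i], so it has a denominator prime to [i]: [b] vanishes to
    the needed orders at the poles of [x / y], all of which are other places. *)
Lemma denominator i x y : x != 0 -> y != 0 -> v i y <= v i x ->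
  exists2 b, b != 0 & [/\ A b, v i b = 0 & A (b * x / y)].
Proof.
move=> x0 y0 yx; have [S uS Sx] := supportP x0; have [T uT Ty] := supportP y0.
pose n j := if j == i then 0 else Num.max 0 (v j y - v j x).
have [|b [b0 vb vb']] := @approximation (undup (i :: S ++ T)) n; first exact: undup_uniq.
have b_ge j : v j b >= 0.
  case: (boolP (j \in undup (i :: S ++ T))) => [/vb->|/vb'//].
  by rewrite /n; case: ifP => // _; lia.
exists b => //; split.
- by move=> j _; rewrite vgeE.
- by rewrite vb ?mem_undup ?mem_head // /n eqxx.
move=> j _; rewrite vgeE ?mulf_neq0 ?invr_eq0 // !(valM dt) ?mulf_neq0 ?invr_eq0 // valV //.
case: (boolP (j \in undup (i :: S ++ T))) => [/vb->|].
  by rewrite /n; case: eqVneq => [->|_]; lia.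
rewrite mem_undup inE mem_cat !negb_or => /and3P[_ /Sx-> /Ty->].
by have := b_ge j; lia.
Qed.

Lemma integerX x n : A x -> A (x ^+ n).
Proof.
move=> Ax; elim: n => [|n IHn]; first by rewrite expr0; apply: integer1.
by rewrite exprS; apply: integerM.
Qed.

Lemma integer_frac_field : is_frac_field A.
Proof.
move=> x; have [->|x0] := eqVneq x 0.
  by exists 0, 1; rewrite mul0r oner_neq0; split=> //; [apply: integer0 | apply: integer1].
have [S uS Sx] := supportP x0.
have [b [b0 vb vb']] := @approximation S (fun j => `|v j x|) uS.
have Ab : A b.
  move=> j _; rewrite vgeE //; case: (boolP (j \in S)) => [/vb->//|/vb'//].
exists (b * x), b; split=> //; last by rewrite mulrAC mulfV ?mul1r.
move=> j _; rewrite vgeE ?mulf_neq0 // (valM dt) //.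
by case: (boolP (j \in S)) => [/vb->|jS]; [lia | rewrite Sx // addr0 vb'].
Qed.

(** * Prime ideals and the Dedekind property *)

Definition prime_at i (x : K) := A x /\ vge i 1 x.

Lemma prime_at_ideal i : ideal A (prime_at i).
Proof.
split=> [x []//||x y [Ax x1] [Ay y1]|a x Aa [Ax x1]].
- by split; [apply: integer0 | apply: vge0].
- split; last exact: valD dt _ _ _ _ x1 y1.
  by move=> j jF; apply: (valD dt); [apply: Ax | apply: Ay].
- split; first exact: integerM.
  by rewrite -[1]add0r; apply: vgeM x1; apply: Aa.
Qed.

Lemma prime_at_val0 i x : A x -> ~ prime_at i x -> x != 0 /\ v i x = 0.
Proof.
move=> Ax xP; have x0 : x != 0.
  by apply/eqP => x0; apply: xP; rewrite x0; split; [apply: integer0 | apply: vge0].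
split=> //; have := Ax i id; rewrite vgeE // => v0.
suff : ~~ (1 <= v i x) by lia.
by apply/negP => v1; apply: xP; split=> //; rewrite vgeE.
Qed.

(** The nonzero residue of [z] is a root of unity, so a positive power of [z], still in [J], is 1
    modulo [prime_at i]. *)
Lemma ideal_unit J i z : ideal A J -> J z -> ~ prime_at i z ->
  exists2 y, J y & prime_at i (1 - y).
Proof.
move=> [JA _ _ Jm] Jz zP; have [z0 vz] := prime_at_val0 (JA _ Jz) zP.
have [n zn] := residue_torsion dt z0 vz.
have Jzn : J (z ^+ n.+1) by rewrite exprSr; apply: Jm => //; apply: integerX; apply: JA.
exists (z ^+ n.+1) => //; split; first by apply: integerB; [apply: integer1 | apply: JA].
by rewrite -opprB; apply: vgeN.
Qed.

(* For each i in the finite support of x some y_i in J is 1 modulo prime_at i; a high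
   power of the product of the 1 - y_i is then 1 modulo J and divisible by x. *)
Lemma comaximal J x : ideal A J -> J x -> x != 0 ->
  (forall i, 0 < v i x -> exists2 z, J z & ~ prime_at i z) -> J 1.
Proof.
move=> idJ Jx x0 Jout; have [JA J0 JD Jm] := idJ.
have JB y z : J y -> J z -> J (y - z).
  move=> Jy Jz; apply: JD => //; rewrite -mulN1r; apply: Jm => //.
  by rewrite -[-1]add0r; apply: integerB; [apply: integer0 | apply: integer1].
have [S uS Sx] := supportP x0.
pose N := (\sum_(i <- S) `|v i x|)%N.
have vN i : v i x <= N%:Z.
  case: (boolP (i \in S)) => [iS|/Sx->//].
  rewrite /N (big_rem i) //=; lia.
have step (T : seq I) : exists t, [/\ A t, J (1 - t) & forall i, i \in T -> 0 < v i x ->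
  vge i 1 t].
  elim: T => [|i T [t [At Jt tT]]].
    by exists 1; rewrite subrr; split=> //; apply: integer1.
  have [ix|ix] := boolP (0 < v i x); last first.
    by exists t; split=> // j; rewrite inE => /orP[/eqP->|/tT//]; rewrite (negPf ix).
  have [z Jz zP] := Jout i ix; have [y Jy [Ay y1]] := ideal_unit idJ Jz zP.
  exists ((1 - y) * t); split; first exact: integerM.
  - have -> : 1 - (1 - y) * t = (1 - t) + t * y by ring.
    by apply: JD => //; apply: Jm.
  - move=> j; rewrite inE => /orP[/eqP->|jT] jx.
      by rewrite -[1]addr0; apply: vgeM => //; apply: At.
    by rewrite -[1]add0r; apply: vgeM; [apply: Ay | apply: tT].
have [t [At Jt tS]] := step S.
have JtN n : J (1 - t ^+ n).
  elim: n => [|n IHn]; first by rewrite expr0 subrr.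
  have -> : 1 - t ^+ n.+1 = (1 - t) + t * (1 - t ^+ n) by rewrite exprS; ring.
  by apply: JD => //; apply: Jm.
have [t0|t0] := eqVneq t 0; first by have := JtN 1; rewrite expr1 t0 subr0.
suff JN : J (t ^+ N) by have := JD _ _ (JtN N) JN; rewrite subrK.
rewrite -[t ^+ N](divfK x0); apply: Jm => // i _.
rewrite vgeE ?mulf_neq0 ?expf_neq0 ?invr_eq0 // (valM dt) ?expf_neq0 ?invr_eq0 //.
rewrite valX // valV //.
have := At i id; rewrite vgeE // => vt0; have [ix|ix] := boolP (0 < v i x); last first.
  by have tN : 0 <= v i t *+ N; [rewrite mulrn_wge0 | move: ix tN; lia].
have iS : i \in S by apply: contraLR ix => /Sx->; rewrite ltxx.
have := tS i iS ix; rewrite vgeE // => vt1; have := vN i.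
have : 1 *+ N <= v i t *+ N by rewrite lerMn2r vt1 orbT.
rewrite -mulr_natr mul1r natz; lia.
Qed.

(** Descent on the absolute value of [v i x], which is [v i x] itself because [J] lies in [A]. *)
Lemma val_min J i x : ideal A J -> J x -> x != 0 ->
  exists y, [/\ J y, y != 0 & forall z, J z -> z != 0 -> v i y <= v i z].
Proof.
move=> [JA _ _ _]; have [n] := ubnP `|v i x|%N; elim: n => // n IHn in x *.
rewrite ltnS => xn Jx x0; apply: NNPP => noy; apply: (noy).
exists x; split=> // z Jz z0; rewrite leNgt; apply/negP => zx; apply: noy.
apply: (IHn z) => //; have := JA _ Jz i id; have := JA _ Jx i id.
by rewrite !vgeE //; move: zx xn; lia.
Qed.

(** Coefficients are a function, not a sequence as in [fin_gen], so that sums of combinations need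
    no length conditions. *)
Definition span (s : seq K) z :=
  exists2 a : nat -> K, (forall i, A (a i)) & z = \sum_(i < size s) a i * s`_i.

Lemma spanD s y z : span s y -> span s z -> span s (y + z).
Proof.
move=> [a Aa ->] [b Ab ->]; exists (fun i => a i + b i) => [i|].
  by move=> j jF; apply: (valD dt); [apply: Aa | apply: Ab].
by rewrite -big_split; apply: eq_bigr => i _; rewrite mulrDl.
Qed.

Lemma spanM s a z : A a -> span s z -> span s (a * z).
Proof.
move=> Aa [b Ab ->]; exists (fun i => a * b i) => [i|]; first exact: integerM.
by rewrite mulr_sumr; apply: eq_bigr => i _; rewrite mulrA.
Qed.

Lemma span0 s : span s 0.
Proof.
exists (fun=> 0) => [_|]; first exact: integer0.
by rewrite big1 // => i _; rewrite mul0r.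
Qed.

Lemma mem_span (s : seq K) y : y \in s -> span s y.
Proof.
move=> ys; exists (fun i => (i == index y s)%:R) => [i|].
  by case: eqP => _; [apply: integer1 | apply: integer0].
have lt_s : (index y s < size s)%N by rewrite index_mem.
rewrite (bigD1 (Ordinal lt_s)) //= eqxx mul1r nth_index // big1 ?addr0 // => j.
by rewrite -val_eqE /= => /negPf->; rewrite mul0r.
Qed.

(* The generators are one nonzero x together with, for each place in its support, an
   element of minimal valuation there. *)
Lemma integer_noetherian : noetherian A.
Proof.
move=> J idJ; have [JA J0 JD Jm] := idJ.
have [[x [Jx x0]]|noJ] := classic (exists x, J x /\ x != 0); last first.
  exists [::]; split=> [[]//|x Jx]; exists [::]; split=> // [i|].
    by rewrite nth_nil; apply: integer0.
  rewrite big_ord0; apply/eqP/negPn/negP => x0; apply: noJ.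
  by exists x.
have [S uS Sx] := supportP x0.
have step (T : seq I) : exists2 s : seq K, (forall y, y \in s -> J y) &
    forall i, i \in T -> exists2 y, y \in s &
      y != 0 /\ forall z, J z -> z != 0 -> v i y <= v i z.
  elim: T => [|i T [s sJ sT]]; first by exists [::].
  have [y [Jy y0 ymin]] := val_min i idJ Jx x0.
  exists (y :: s) => [z|j]; first by rewrite inE => /orP[/eqP->|/sJ].
  rewrite inE => /orP[/eqP->|/sT[z zs zmin]]; first by exists y; rewrite ?mem_head.
  by exists z; rewrite // inE zs orbT.
have [s sJ sS] := step S; exists (x :: s); split=> [i|z Jz].
  by move=> /(mem_nth 0); rewrite inE => /orP[/eqP->|/sJ].
suff [a Aa zE] : span (x :: s) z.
  exists (mkseq a (size (x :: s))); split.
  - by rewrite size_mkseq.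
  - move=> i; have [lt_i|ge_i] := ltnP i (size (x :: s)); first by rewrite nth_mkseq.
    by rewrite nth_default ?size_mkseq //; apply: integer0.
  - by rewrite zE; apply: eq_bigr => i _; rewrite nth_mkseq.
have [->|z0] := eqVneq z 0; first exact: span0.
(* The conductor of [z] into the span is an ideal containing [x]. At each zero of [x], dividing [z]
   by a generator of minimal value there and clearing denominators gives an element of [C] outside
   [prime_at i]. *)
pose C a := A a /\ span (x :: s) (a * z).
suff [_] : C 1 by rewrite mul1r.
apply: (@comaximal C x) => //.
- split=> [a []//||a b [Aa sa] [Ab sb]|a b Aa [Ab sb]].
  + by split; [apply: integer0 | rewrite mul0r; apply: span0].
  + split; last by rewrite mulrDl; apply: spanD.
    by move=> j jF; apply: (valD dt); [apply: Aa | apply: Ab].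
  + by split; [apply: integerM | rewrite -mulrA; apply: spanM].
- split; first exact: JA.
  by rewrite mulrC; apply: spanM; [apply: JA | apply: mem_span; rewrite mem_head].
- move=> i ix; have iS : i \in S by apply: contraLR ix => /Sx->; rewrite ltxx.
  have [y ys [y0 ymin]] := sS i iS;
    have [b b0 [Ab vb Abzy]] := denominator z0 y0 (ymin z Jz z0).
  exists b => [|[_]]; last by rewrite vgeE // vb.
  split=> //; rewrite -[b * z](divfK y0); apply: spanM => //.
  by apply: mem_span; rewrite inE ys orbT.
Qed.

Lemma integer_closed : integrally_closed A.
Proof.
move=> x [p [p_monic Ap /rootP px]]; apply/integerP => i.
have [->|x0] := eqVneq x 0; first exact: vge0.
rewrite vgeE // leNgt; apply/negP => vx.
have p0 := monic_neq0 p_monic; set n := (size p).-1.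
have pn : size p = n.+1 by rewrite prednK // size_poly_gt0.
move: px; rewrite horner_coef pn big_ord_recr /=.
rewrite -[p`_n]/(lead_coef p) (monicP p_monic) mul1r => /eqP.
rewrite addrC addr_eq0 => /eqP xn.
(* If [x] had a pole at [i], every lower term of the monic equation would have value at least that
   of [x ^+ n.-1], strictly above that of [x ^+ n]. *)
have ge_xn : vge i (v i x *+ n - v i x) (x ^+ n).
  rewrite xn; apply: vgeN; elim/big_ind: _ => [|y z|j _]; first exact: vge0.
    exact: valD dt _ _ _ _.
  rewrite -[_ - _]add0r; apply: vgeM; first exact: Ap.
  rewrite vgeE ?expf_neq0 // valX //; move: (nat_of_ord j) (ltn_ord j) => k kn.
  have -> : n = (k + (n - k.+1).+1)%N by lia.
  rewrite mulrnDr mulrS; have : v i x *+ (n - k.+1) <= 0 by rewrite mulrn_wle0 // ltW.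
  by lia.
by move: ge_xn; rewrite vgeE ?expf_neq0 // valX //; lia.
Qed.

Lemma prime_at_maximal i : maximal_ideal A (prime_at i).
Proof.
split=> [||J idJ PJ]; first exact: prime_at_ideal.
  by case=> _; rewrite vgeE ?oner_neq0 // val1.
have [JA J0 JD Jm] := idJ.
have [JP|nJP] := classic (forall x, J x -> prime_at i x).
  by right=> x; split=> [/JP|/PJ].
have [z Jz zP] : exists2 z, J z & ~ prime_at i z.
  by apply: NNPP => noz; apply: nJP => x Jx; apply: NNPP => xP; apply: noz; exists x.
left; have [y Jy y1] := ideal_unit idJ Jz zP.
by rewrite -(subrK y 1); apply: JD => //; apply: PJ.
Qed.

Lemma seteq_maximal P Q : seteq P Q -> maximal_ideal A P -> maximal_ideal A Q.
Proof.
move=> PQ [[PA P0 PD PM] P1 Pmax]; split; first split.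
- by move=> x /PQ/PA.
- exact/PQ.
- by move=> x y /PQ Px /PQ Py; apply/PQ/PD.
- by move=> a x Aa /PQ Px; apply/PQ/PM.
- by move=> /PQ.
- move=> J idJ QJ; have [|J1|JP] := Pmax J idJ; [by move=> x /PQ/QJ | by left | right].
  by move=> x; split=> [/JP/PQ | /PQ/JP].
Qed.

Lemma prime_maximal Q : prime_ideal A Q -> (exists x, Q x /\ x != 0) ->
  maximal_ideal A Q.
Proof.
move=> [idQ Q1 Qprime] [x [Qx x0]]; have [QA Q0 QD QM] := idQ.
(* Otherwise [Q] meets the complement of every [prime_at i], and comaximality puts 1 in [Q]. *)
have [i QP] : exists i, forall y, Q y -> prime_at i y.
  apply: NNPP => noi; apply: Q1; apply: (comaximal idQ Qx x0) => i _.
  apply: NNPP => noz; apply: noi; exists i => y Qy; apply: NNPP => yP.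
  by apply: noz; exists y.
have QX y n : A y -> Q (y ^+ n) -> Q y.
  move=> Ay; elim: n => [|n IHn]; first by rewrite expr0.
  by rewrite exprS => /Qprime[]//; apply: integerX.
apply: seteq_maximal (prime_at_maximal i) => z; split=> [[Az z1]|/QP//].
(* With this exponent [z ^+ m] vanishes at [i] at least as much as [x], so some [b] outside
   [prime_at i] makes [b * z ^+ m] a multiple of [x]. Primality of [Q] then yields [z]. *)
have [->//|z0] := eqVneq z 0; pose m := `|v i x|%N.
have zm : z ^+ m != 0 by rewrite expf_neq0.
have [|b b0 [Ab vb Abzx]] := @denominator i (z ^+ m) x zm x0.
  move: z1; rewrite valX // vgeE // => z1.
  have : 1 *+ m <= v i z *+ m by rewrite lerMn2r z1 orbT.
  by rewrite -mulr_natr mul1r natz /m; lia.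
have : Q (b * z ^+ m) by rewrite -(divfK x0 (b * _)); apply: QM.
move=> /Qprime[||/QP[_]|/QX]//; first exact: integerX; last by apply.
by rewrite vgeE // vb.
Qed.

Lemma integer_dedekind : dedekind A.
Proof. split; [exact: integer_noetherian | exact: integer_closed | exact: prime_maximal].
  Qed.

(** * Overrings *)

Definition negative_at (D : K -> Prop) i := exists2 d, D d & ~ vge i 0 d.

(** The conductor of [x] into [D] escapes every [prime_at i]: where some element of [D] has a pole,
    a power of it absorbs the pole of [x], and at the remaining places [x] is regular. Comaximality
    then puts 1 in the conductor. *)
Lemma overring_inverting D : overring A D -> seteq D (inverting (negative_at D)).
Proof.
move=> [[D0 D1 DB DM] AD] x; split=> [Dx i nDi|Dx].
  by apply: NNPP => xi; apply: nDi; exists x.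
have [->//|x0] := eqVneq x 0.
have DX y n : D y -> D (y ^+ n).
  by move=> Dy; elim: n => [|n IHn]; rewrite ?expr0 // exprS; apply: DM.
have DD y z : D y -> D z -> D (y + z).
  by move=> Dy Dz; rewrite -[z]opprK -[- z]sub0r; exact: (DB _ _ Dy (DB _ _ D0 Dz)).
pose C a := A a /\ D (a * x).
suff [_] : C 1 by rewrite mul1r.
have [a [b [Aa Ab b0 xE]]] := integer_frac_field x.
apply: (@comaximal C b) => //.
- split=> [y []//||y z [Ay sy] [Az sz]|y z Ay [Az sz]].
  + by split; [apply: integer0 | rewrite mul0r].
  + split; last by rewrite mulrDl; apply: DD.
    by move=> j jF; apply: (valD dt); [apply: Ay | apply: Az].
  + by split; [apply: integerM | rewrite -mulrA; apply: DM => //; apply: AD].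
- by split=> //; rewrite xE mulrC divfK //; apply: AD.
move=> i _; have [[d Dd d_neg]|nDi] := classic (negative_at D i).
- have d0 : d != 0 by apply/eqP => d0; apply: d_neg; rewrite d0; apply: vge0.
  have dn : d ^+ `|v i x|%N != 0 by rewrite expf_neq0.
  have [|e e0 [Ae ve Aexd]] := @denominator i x (d ^+ `|v i x|%N) x0 dn.
    rewrite valX //; move: d_neg; rewrite vgeE // => /negP d_neg.
    have : v i d *+ `|v i x|%N <= -1 *+ `|v i x|%N by rewrite lerMn2r; apply/orP; right;
      lia.
    by rewrite -[(-1) *+ _]mulr_natr mulN1r natz; lia.
  exists e => [|[_]]; last by rewrite vgeE // ve.
  split=> //; rewrite -(divfK dn (e * x)); apply: DM; first exact: AD.
  exact: DX.
- have := Dx i nDi; rewrite vgeE // => vx; rewrite -(val1 i) in vx.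
  have [e e0 [Ae ve Aex]] := denominator x0 (oner_neq0 K) vx.
  exists e => [|[_]]; last by rewrite vgeE // ve.
  by split=> //; apply: AD; rewrite divr1 in Aex.
Qed.

Lemma inverting_negative Delta i : negative_at (inverting Delta) i <-> Delta i.
Proof.
split=> [[d Dd d_neg]|Di]; first by apply: NNPP => /Dd.
have [x [x0 vx vx']] := @approximation [:: i] (fun=> -1) isT.
exists x; last by rewrite vgeE // vx ?mem_head.
move=> j nDj; rewrite vgeE // vx' // inE.
by apply/negP => /eqP ji; apply: nDj; rewrite ji.
Qed.

Lemma overringE D : overring A D -> exists Delta, D = inverting Delta.
Proof. by move=> AD; exists (negative_at D); apply/pred_ext/overring_inverting. Qed.

Lemma unit_invertingP Delta x : unit_of (inverting Delta) x <->
  x != 0 /\ forall i, ~ Delta i -> v i x = 0.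
Proof.
split=> [[Dx [y [Dy xy]]]|[x0 vx]].
  have x0 : x != 0 by apply/eqP => x0; move/eqP: xy; rewrite x0 mul0r eq_sym oner_eq0.
  have y0 : y != 0 by apply/eqP => y0; move/eqP: xy; rewrite y0 mulr0 eq_sym oner_eq0.
  split=> // i nDi; have := Dx i nDi; have := Dy i nDi; rewrite !vgeE //.
  by have := valM dt i x0 y0; rewrite xy val1; lia.
split=> [i nDi|]; first by rewrite vgeE // vx.
exists x^-1; rewrite mulfV //; split=> // i nDi.
by rewrite vgeE ?invr_eq0 // valV // vx.
Qed.

Lemma unit_integerP x : unit_of A x <-> x != 0 /\ forall i, v i x = 0.
Proof.
by split=> [/unit_invertingP[x0 vx]|[x0 vx]]; [split=> // i;
  apply: vx | apply/unit_invertingP].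
Qed.

(** * Overrings sorted by the signs of the classes *)

Lemma principal_pair i j a b : i != j -> c i * a + c j * b = 0 ->
  exists2 x, x != 0 & forall k, v k x = if k == i then a else if k == j then b else 0.
Proof.
move=> ij ab; have [||x x0 vx] := @principal _ _ _ _ dt [:: i;
  j] (fun k => if k == i then a else b).
- by rewrite /= inE ij.
- by rewrite !big_cons big_nil eqxx eq_sym (negPf ij) addr0.
by exists x => // k; rewrite vx !inE; do 2![case: eqP].
Qed.

(** For [e = 1] and [e = -1] these are the places of positive and of negative class; the factor [e]
    lets both signs share their proofs. *)
Definition side (e : int) i : Prop := 0 < e * c i.

Lemma opposite_class_neq i j : 0 < c i -> c j < 0 -> i != j.
Proof. by move=> ci cj; apply: contraTneq ci => ->; lia. Qed.

(** Classes of opposite sign cancel with the positive multiplicities [- c j] and [c i]. *)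
Lemma opposite_pair i j : 0 < c i -> c j < 0 -> exists2 x, x != 0 &
  [/\ 0 < v i x, 0 < v j x & forall k, k != i -> k != j -> v k x = 0].
Proof.
move=> ci cj; have ij := opposite_class_neq ci cj.
have [|x x0 vx] := @principal_pair i j (- c j) (c i) ij; first by ring.
exists x => //; split; rewrite ?vx ?eqxx ?[j == i]eq_sym ?(negPf ij) //; first by lia.
by move=> k ki kj; rewrite vx (negPf ki) (negPf kj).
Qed.

(** Any place of [Delta] can be paired with [i] or [j], whichever has the opposite sign. This gives
    an element of [A] vanishing there and supported in [Delta]; products of powers of such elements
    are denominators for the whole overring. *)
Lemma mixed_localization Delta i j : Delta i -> Delta j -> 0 < c i -> c j < 0 ->
  localization_of A (inverting Delta).
Proof.
move=> Di Dj ci cj.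
pose S s := [/\ A s, s != 0 & forall k, ~ Delta k -> v k s = 0].
have SM s t : S s -> S t -> S (s * t).
  move=> [As s0 vs] [At t0 vt]; split; [exact: integerM | by rewrite mulf_neq0 |].
  by move=> k nDk; rewrite (valM dt) // vs // vt.
have S1 : S 1 by split=> [||k _]; [apply: integer1 | apply: oner_neq0 | apply: val1].
have SX s n : S s -> S (s ^+ n).
  by move=> Ss; elim: n => [|n IHn]; rewrite ?expr0 // exprS; apply: SM.
have Spos k : Delta k -> exists2 s, S s & 0 < v k s.
  move=> Dk; have [ck|ck|/eqP] := ltgtP (c k) 0; last by rewrite (negPf (class_neq0 dt k)).
    have [x x0 [vi vk vx]] := opposite_pair ci ck; exists x => //.
    split=> // [l _|l nDl]; last by apply: vx; apply/eqP => lE; apply: nDl; rewrite lE.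
    rewrite vgeE //; have [->|li] := eqVneq l i; first by rewrite ltW.
    by have [->|lk] := eqVneq l k; [rewrite ltW | rewrite vx].
  have [x x0 [vk vj vx]] := opposite_pair ck cj; exists x => //.
  split=> // [l _|l nDl]; last by apply: vx; apply/eqP => lE; apply: nDl; rewrite lE.
  rewrite vgeE //; have [->|lk] := eqVneq l k; first by rewrite ltW.
  by have [->|lj] := eqVneq l j; [rewrite ltW | rewrite vx].
exists S; split=> [s []//|//|//|x]; split=> [Dx|[a [s [Aa [As s0 vs] ->]]]]; last first.
  move=> k nDk; have [->|a0] := eqVneq a 0; first by rewrite mul0r; apply: vge0.
  rewrite vgeE ?mulf_neq0 ?invr_eq0 // (valM dt) ?invr_eq0 // valV // vs // oppr0 addr0.
  by have := Aa k id; rewrite vgeE.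
have [->|x0] := eqVneq x 0.
  by exists 0, 1; rewrite mul0r; split=> //; apply: integer0.
have [T uT Tx] := supportP x0.
have [s Ss sT] : exists2 s, S s & forall k, k \in T -> 0 <= v k s + v k x.
  elim: (T) => [|k U [s Ss sU]]; first by exists 1.
  have [vk|vk] := leP 0 (v k x).
    exists s => // l; rewrite inE => /orP[/eqP->|/sU//].
    by have [As s0 _] := Ss; have := As k id; rewrite vgeE //; lia.
  have Dk : Delta k by apply: NNPP => /Dx; rewrite vgeE //; lia.
  have [t St tk] := Spos k Dk; have Stn := SX t `|v k x|%N St.
  have [As s0 _] := Ss; have [Atn tn0 _] := Stn; have [At t0 _] := St.
  exists (s * t ^+ `|v k x|%N) => [|l]; first exact: SM.
  have := As l id; have := Atn l id; rewrite !vgeE // => tl sl.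
  rewrite (valM dt) // inE => /orP[/eqP lk|/sU]; last by lia.
  have : 1 *+ `|v k x|%N <= v k t *+ `|v k x|%N by rewrite lerMn2r; apply/orP; right; lia.
  by rewrite -mulr_natr mul1r natz; move: sl tl; rewrite lk valX //; lia.
exists (s * x), s; have [As s0 vs] := Ss; split=> //; last by rewrite mulrAC mulfV ?mul1r.
move=> k _; rewrite vgeE ?mulf_neq0 // (valM dt) //.
have [/sT//|/Tx->] := boolP (k \in T); rewrite addr0.
by have := As k id; rewrite vgeE.
Qed.

Lemma empty_localization Delta : (forall i, ~ Delta i) ->
  localization_of A (inverting Delta).
Proof.
move=> D0; have -> : Delta = fun=> False by apply: pred_ext => i; split=> [/D0|].
exists (eq 1); split=> // [s <-|s t <- <-|x]; rewrite ?mulr1 //.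
  by split; [apply: integer1 | apply: oner_neq0].
split=> [Ax|[a [s [Aa <- ->]]]]; last by rewrite divr1.
by exists x, 1; rewrite divr1; split=> //; apply: integer1.
Qed.

Section OneSided.
Variables (e : int) (Delta : I -> Prop).
Hypotheses (e0 : e != 0) (De : forall i, Delta i -> side e i).

Lemma one_sided_unit x : x != 0 -> (forall i, Delta i -> 0 <= v i x) ->
  (forall i, ~ Delta i -> v i x = 0) -> forall i, v i x = 0.
Proof.
move=> x0 xD xnD; apply: (degree0_one_sided e0 x0) => i.
have [Di|/xnD->] := classic (Delta i); last by rewrite mulr0.
by apply: mulr_ge0; [apply/ltW/De | apply: xD].
Qed.

(** A denominator is a unit of the overring, hence by the degree a unit of [A]. The localization
    would then be [A] itself, but some element has a pole at [i]. *)
Lemma one_sided_not_localization i : Delta i -> ~ localization_of A (inverting Delta).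
Proof.
move=> Di [S [SA S1 SM DE]].
have [d Dd d_neg] := (inverting_negative Delta i).2 Di.
have d0 : d != 0 by apply/eqP => d0; apply: d_neg; rewrite d0; apply: vge0.
have [a [s [Aa Ss dE]]] := (DE d).1 Dd; have [As s0] := SA s Ss.
have a0 : a != 0 by apply: contraNneq d0 => a0; rewrite dE a0 mul0r.
have Ds : inverting Delta s^-1.
  by apply/DE; exists 1, s; rewrite mul1r; split=> //; apply: integer1.
have vs : forall k, v k s = 0.
  apply: one_sided_unit => // k nDk; first by have := As k id; rewrite vgeE.
  have := Ds k nDk; have := As k id; rewrite !vgeE ?invr_eq0 // valV //; lia.
apply: d_neg; rewrite dE vgeE ?mulf_neq0 ?invr_eq0 // (valM dt) ?invr_eq0 // valV // vs.
by have := Aa i id; rewrite vgeE // oppr0 addr0.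
Qed.

Lemma one_sided_units i x : Delta i ->
  (unit_of (inverting Delta) x /\ A x) <-> unit_of A x.
Proof.
move=> Di; split=> [[/unit_invertingP[x0 vx] Ax]|/unit_integerP[x0 vx]].
  apply/unit_integerP; split=> //; apply: one_sided_unit => // k _.
  by have := Ax k id; rewrite vgeE.
by split; [apply/unit_invertingP; split=> // | move=> k _; rewrite vgeE // vx].
Qed.

(** If a place [j] of the side were not inverted, an element with a zero at [j] and a pole at [i]
    could not be corrected: the unit [u] would be regular on [Delta], hence trivial by the degree,
    and the pole would remain. *)
Lemma one_sided_almost_well_centered i : Delta i ->
  almost_well_centered A (inverting Delta) -> Delta = side e.
Proof.
move=> Di awc; apply: pred_ext => j; split=> [/De//|ej]; apply: NNPP => nDj.
have ji : j != i by apply/eqP => ji; apply: nDj; rewrite ji.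
have ei := De Di.
have [|x x0 vx] := @principal_pair j i (e * c i) (- (e * c j)) ji; first by ring.
have Dx : inverting Delta x.
  move=> k nDk; rewrite vgeE // vx; case: eqP => [_|_]; first exact: ltW.
  by case: eqP => // ki; case: nDk; rewrite ki.
have [n [n_gt0 [u [/unit_invertingP[u0 vu] Aux]]]] := awc x Dx.
have vux k : 0 <= v k u + v k x *+ n.
  have := Aux k id; rewrite vgeE ?mulf_neq0 ?expf_neq0 // (valM dt) ?expf_neq0 //.
  by rewrite valX.
have iv : v i x *+ n < 0.
  by rewrite vx eq_sym (negPf ji) eqxx pmulrn_llt0 // oppr_lt0.
have : v i u = 0; last by have := vux i; lia.
apply: one_sided_unit => // k Dk; have := vux k; rewrite vx.
have [kj|_] := eqVneq k j; first by case: nDj; rewrite -kj.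
have [->|_] := eqVneq k i; last by rewrite mul0rn addr0.
by move: iv; rewrite vx eq_sym (negPf ji) eqxx; lia.
Qed.

End OneSided.

(** On the side [e] the unit [u] cancels the power of [d] and leaves a zero of order [t] at [i]. The
    exponent makes the degree to be compensated the multiple [c i * t]. As [d] is regular off the
    side and has degree 0, [t] is nonnegative. *)
Lemma side_unit e i d : side e i -> inverting (side e) d -> d != 0 ->
  exists u, unit_of (inverting (side e)) u /\ A (u * d ^+ absz (e * c i)).
Proof.
move=> ei Dd d0; have [T uT Td] := supportP d0.
(* Putting [i] in front isolates its term whether or not it lies in [T]. *)
pose S := i :: rem i T; have uS : uniq S by rewrite /= mem_rem_uniq // inE eqxx rem_uniq.
have Sd k : k \notin S -> v k d = 0.
  by rewrite inE negb_or mem_rem_uniq // inE => /andP[-> kT]; apply: Td.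
pose G k := if 0 < e * c k then c k * v k d else 0.
pose t := e * \sum_(k <- S) G k.
have t_ge0 : 0 <= t.
  have sum0 : \sum_(k <- S) c k * v k d = 0 by apply: degree0_sum.
  have -> : t = t - e * \sum_(k <- S) c k * v k d by rewrite sum0 mulr0 subr0.
  rewrite /t !mulr_sumr -sumrB; apply: sumr_ge0 => k _; rewrite /G.
  case: ifPn => [_|ek]; first by rewrite subrr.
  rewrite mulr0 add0r mulrA oppr_ge0; apply: mulr_le0_ge0; first by rewrite leNgt.
  by have := Dd k (negP ek); rewrite vgeE.
pose n k := if 0 < e * c k then (if k == i then t else 0) - (e * c i) * v k d else 0.
have [|u u0 vu] := @principal _ _ _ _ dt S n uS.
  have nE k : k \in rem i T -> c k * n k = - (e * c i) * G k.
    rewrite mem_rem_uniq // inE => /andP[ki _]; rewrite /n /G (negPf ki).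
    by case: ifP => _; ring.
  rewrite big_cons (eq_big_seq _ nE) -mulr_sumr /n eqxx ei.
  have : t = e * (G i + \sum_(k <- rem i T) G k) by rewrite /t big_cons.
  by rewrite {1}/G ei => ->; ring.
exists u; split.
  by apply/unit_invertingP; split=> // k nek; rewrite vu /n (introF idP nek) if_same.
move=> k _; rewrite vgeE ?mulf_neq0 ?expf_neq0 // (valM dt) ?expf_neq0 // valX // vu.
rewrite -mulr_natr natz gez0_abs ?(ltW ei) //.
case: ifPn => [kS|/Sd->]; last by rewrite mul0r.
rewrite /n; case: ifPn => [ek|ek].
  by case: ifP => _; rewrite [v k d * _]mulrC addrNK.
rewrite add0r; apply: mulr_ge0; last exact: ltW.
by have := Dd k (negP ek); rewrite vgeE.
Qed.

Lemma side_inhabited e : e = 1 \/ e = -1 -> exists i, side e i.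
Proof.
have [i _ ci] := class_two dt [::]; have [j _ cj] := class_opp1 dt [::].
by case=> ->; [exists i | exists j]; rewrite /side ?ci ?cj.
Qed.

Lemma side_almost_well_centered e : e = 1 \/ e = -1 ->
  almost_well_centered A (inverting (side e)).
Proof.
move=> he; have [i ei] := side_inhabited he.
exists (absz (e * c i)); split; first by move: ei; rewrite /side absz_gt0 => /lt0r_neq0.
have [->|d0] := eqVneq d 0; last exact: side_unit.
exists 1; split; first by apply/unit_invertingP; split=> [|j _];
  [apply: oner_neq0 | apply: val1].
rewrite mul1r expr0n; case: eqP => _; [exact: integer1 | exact: integer0].
Qed.

Lemma trichotomy Delta : [\/ forall i, ~ Delta i,
  exists i j, [/\ Delta i, Delta j, 0 < c i & c j < 0] |
  exists e i, [/\ e = 1 \/ e = -1, Delta i & forall j, Delta j -> side e j]].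
Proof.
have [[i Di]|noD] := classic (exists i, Delta i); last first.
  by constructor 1 => i Di; apply: noD; exists i.
have [[[j [Dj cj]] [k [Dk ck]]]|nomix] :=
  classic ((exists j, Delta j /\ 0 < c j) /\ (exists k, Delta k /\ c k < 0)).
  by constructor 2; exists j, k.
constructor 3; have ci := class_neq0 dt.
have [[j [Dj cj]]|nopos] := classic (exists j, Delta j /\ 0 < c j).
  exists 1, i; split=> [|//|k Dk]; first by left.
  rewrite /side mul1r lt_neqAle eq_sym ci leNgt; apply/negP => ck.
  by apply: nomix; split; [exists j | exists k].
exists (-1), i; split=> [|//|k Dk]; first by right.
rewrite /side mulN1r oppr_gt0 lt_neqAle ci leNgt; apply/negP => ck.
by apply: nopos; exists k.
Qed.

Lemma inverting_sides_neq : ~ seteq (inverting (side 1)) (inverting (side (-1))).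
Proof.
have [i [x [x0 xi Dx]]] : exists i x, [/\ x != 0, side 1 i /\ v i x < 0 &
  inverting (side 1) x].
  have [i ei] := side_inhabited (or_introl erefl).
  have [x Dx x_neg] := (inverting_negative (side 1) i).2 ei.
  have x0 : x != 0 by apply/eqP => x0; apply: x_neg; rewrite x0; apply: vge0.
  by exists i, x; split=> //; split=> //; move: x_neg; rewrite vgeE //; lia.
move=> /(_ x)[/(_ Dx)/(_ i) + _]; case: xi => ei xi; rewrite vgeE // => H.
by have := H _; move: ei xi; rewrite /side => ei xi H'; suff : 0 <= v i x;
  [lia | apply: H'; lia].
Qed.

Lemma inverting_empty_seteq Delta : seteq (inverting Delta) A -> forall i, ~ Delta i.
Proof.
move=> DA i Di; have [x Dx] := (inverting_negative Delta i).2 Di; apply.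
exact: (DA x).1 Dx i id.
Qed.

Lemma almost_well_centered_sides Delta e i : e = 1 \/ e = -1 -> Delta i ->
  (forall j, Delta j -> side e j) -> almost_well_centered A (inverting Delta) ->
  seteq (inverting Delta) (inverting (side 1)) \/ seteq (inverting Delta) (inverting
    (side (-1))).
Proof.
move=> he Di De awc; have e0 : e != 0 by case: he => ->.
rewrite (one_sided_almost_well_centered e0 De Di awc).
by case: he => ->; [left | right].
Qed.

Lemma sides_cases D (P : (K -> Prop) -> Prop) :
  (forall e, e = 1 \/ e = -1 -> P (inverting (side e))) ->
  seteq D (inverting (side 1)) \/ seteq D (inverting (side (-1))) -> P D.
Proof. by move=> HP [/pred_ext->|/pred_ext->]; apply: HP; [left | right]. Qed.

(** Overrings correspond to sets [Delta] of places. Empty and mixed sets give localizations, and a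
    one-sided set must be a full side. *)
Lemma integer_two_awc : two_awc_property A.
Proof.
exists (inverting (side 1)), (inverting (side (-1))).
split=> [||| D | D]; [exact: inverting_overring | exact: inverting_overring | exact:
  inverting_sides_neq | |];
  move=> /overringE[Delta ->{D}].
- split; last first.
    apply: (@sides_cases _ (fun D =>
      almost_well_centered A D /\ ~ localization_of A D)) => e he.
    split; first exact: side_almost_well_centered.
    have [i ei] := side_inhabited he; have e0 : e != 0 by case: he => ->.
    exact: (one_sided_not_localization e0 (fun _ h => h) ei).
  move=> [awc nloc]; have [D0|[i [j [Di Dj ci cj]]]|[e [i [he Di De]]]] := trichotomy Delta.
  + by case: nloc; apply: empty_localization.
  + by case: nloc; apply: mixed_localization ci cj.
  + exact: (almost_well_centered_sides he Di De awc).
- split; last first.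
    apply: (@sides_cases _ (fun D => [/\ ~ seteq D A, almost_well_centered A D &
      forall x, (unit_of D x /\ A x) <-> unit_of A x])) => e he.
    have [i ei] := side_inhabited he; have e0 : e != 0 by case: he => ->.
    split; [|exact: side_almost_well_centered|by move=> x;
      apply: (one_sided_units e0 (fun _ h => h) _ ei)].
    by move=> /inverting_empty_seteq/(_ i).
  move=> [DA awc units];
    have [D0|[i [j [Di Dj ci cj]]]|[e [i [he Di De]]]] := trichotomy Delta.
  + by case: DA => x; split=> H; [apply/integerP => i; apply: H | move=> i _; apply: H].
  (* This element of [A] is a unit of the overring but not of [A], against the condition on
     units. *)
  + have [x x0 [xi xj vx]] := opposite_pair ci cj.
    suff /unit_integerP[_ vi0] : unit_of A x by move: xi; rewrite vi0.
    apply/units; split.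
      apply/unit_invertingP; split=> // k nDk; apply: vx; apply/eqP => kE; apply: nDk;
        rewrite kE //.
    apply/integerP => k; rewrite vgeE //.
    have [->|ki] := eqVneq k i; first exact: ltW.
    by have [->|kj] := eqVneq k j; [exact: ltW | rewrite vx].
  + exact: (almost_well_centered_sides he Di De awc).
Qed.

(** A place of class -1 brings the exponent in [side_unit] down to 1. *)
Lemma negative_side_well_centered : well_centered A (inverting (side (-1))).
Proof.
move=> d Dd; have [->|d0] := eqVneq d 0.
  exists 1; rewrite mulr0; split; last exact: integer0.
  by apply/unit_invertingP; split=> [|i _]; [apply: oner_neq0 | apply: val1].
have [i _ ci] := class_opp1 dt [::].
have ei : side (-1) i by rewrite /side ci.
by have [u] := side_unit ei Dd d0; rewrite ci mulrNN mul1r expr1; exists u.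
Qed.

(* With no place of class 1, an element of divisor q3 - q2 + n, of classes 3, 2 and -1,
   cannot be made integral by a unit: the positive part would have degree 1. *)
Lemma positive_side_not_well_centered i : (forall j, 0 < c j -> 2 <= c j) ->
  c i = 3 -> ~ well_centered A (inverting (side 1)).
Proof.
move=> c_ge2 ci wc; have [j] := class_two dt [:: i]; rewrite inE => ji cj.
have [k] := class_opp1 dt [:: i; j]; rewrite !inE negb_or => /andP[ki kj] ck.
pose n l : int := if l == j then -1 else 1.
have [||d d0 vd] := @principal _ _ _ _ dt [:: k; i; j] n.
- by rewrite /= !inE negb_or ki kj eq_sym ji.
- by rewrite !big_cons big_nil /n (negPf kj) eqxx [i == j]eq_sym (negPf ji) ci cj ck.
have Dd : inverting (side 1) d.
  move=> l; rewrite /side mul1r vgeE // vd /n; case: ifP => // _.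
  by case: eqP => // -> []; rewrite cj.
have [u [/unit_invertingP[u0 vu] Aud]] := wc d Dd.
have y0 : u * d != 0 by rewrite mulf_neq0.
have y_ge l : 0 <= v l (u * d) by have := Aud l id; rewrite vgeE.
have y_neg l : c l < 0 -> v l (u * d) = (l == k)%:R.
  move=> cl; rewrite (valM dt) // vu ?add0r ?vd; last by rewrite /side mul1r; lia.
  rewrite !inE /n; have [li|_] := eqVneq l i; first by move: cl; rewrite li ci.
  have [lj|_] := eqVneq l j; first by move: cl; rewrite lj cj.
  by rewrite !orbF; case: eqP.
have [T uT Ty] := supportP y0.
have kT : k \in T by apply/negPn/negP => /Ty; rewrite y_neg ?ck // eqxx.
have := degree0_sum y0 uT Ty; rewrite (bigD1_seq k) //= y_neg ?ck // eqxx mulr1.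
have term l : l != k -> 0 <= c l * v l (u * d).
  move=> lk; have [cl|cl] := ltP (c l) 0; first by rewrite y_neg // (negPf lk) mulr0.
  exact: mulr_ge0.
have [[l [lk lT vl]]|all0] := classic (exists l, [/\ l != k, l \in T & v l (u * d) != 0]).
  rewrite -big_filter (bigD1_seq l) /= ?mem_filter ?lk ?filter_uniq //.
  have cl : 0 < c l.
    by rewrite lt_neqAle eq_sym (class_neq0 dt) leNgt; apply: contra vl => /y_neg->;
      rewrite (negPf lk).
  have : 2 <= c l * v l (u * d).
    rewrite -[2]mulr1; apply: ler_pM => //; first exact: c_ge2.
    by rewrite -gtz0_ge1 lt_neqAle eq_sym vl y_ge.
  set s := (X in _ + (_ + X)).
  have : 0 <= s.
    rewrite /s big_seq_cond; apply: sumr_ge0 => m.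
    by rewrite mem_filter => /andP[/andP[mk _] _]; apply: term.
  by move: s (c l * _) => s y; lia.
rewrite big1_seq // => l /andP[lk lT]; have [->|vl] := eqVneq (v l (u * d)) 0;
  first by rewrite mulr0.
by case: all0; exists l.
Qed.

End DivisorTheory.

(** * Integral polynomials and primes *)

(** At 0 the value is 0 rather than infinite, so later statements carry nonvanishing separately. *)
Definition vp (p : nat) (z : int) : nat := logn p `|z|.

Lemma vp_dvd p m z : prime p -> z != 0 -> (p%:Z ^+ m %| z)%Z = (m <= vp p z)%N.
Proof.
by move=> p_pr z0; rewrite dvdzE abszX /= pfactor_dvdn // absz_gt0.
Qed.

Lemma vpM p x y : x != 0 -> y != 0 -> vp p (x * y) = (vp p x + vp p y)%N.
Proof. by move=> x0 y0; rewrite /vp abszM lognM // absz_gt0. Qed.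

Lemma vp_exact p m z : prime p -> (p%:Z ^+ m %| z)%Z -> ~~ (p%:Z ^+ m.+1 %| z)%Z ->
  z != 0 /\ vp p z = m.
Proof.
move=> p_pr pm pm1; have z0 : z != 0 by apply: contraNneq pm1 => ->; rewrite dvdz0.
by split=> //; move: pm pm1; rewrite !vp_dvd //; lia.
Qed.

Lemma vp_eq0 p z : prime p -> ~~ (p%:Z %| z)%Z -> vp p z = 0%N.
Proof. by move=> p_pr pz; have [|//|] := @vp_exact p 0 z p_pr;
  rewrite ?expr0 ?dvd1z ?expr1. Qed.

Lemma dvdz_congr (d x y : int) : (d %| x - y)%Z -> (d %| x)%Z = (d %| y)%Z.
Proof. by move=> dxy; rewrite -[x](subrK y) rpredDl. Qed.

Lemma dvdz_exp_le (p : int) m n z : (m <= n)%N -> (p ^+ n %| z)%Z -> (p ^+ m %| z)%Z.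
Proof. by move=> mn; apply: dvdz_trans; apply: dvdz_exp2l. Qed.

(** The valuation of [y] lies below the precision [e], so the congruence determines that of [x]. *)
Lemma vp_congr p e x y : prime p -> (p%:Z ^+ e %| x - y)%Z -> ~~ (p%:Z ^+ e %| y)%Z ->
  x != 0 /\ vp p x = vp p y.
Proof.
move=> p_pr xy ye; have y0 : y != 0 by apply: contraNneq ye => ->; rewrite dvdz0.
have /ltnW lt_e : (vp p y < e)%N by rewrite ltnNge -vp_dvd.
have lt_e' : ((vp p y).+1 <= e)%N by rewrite ltnNge -vp_dvd.
apply: vp_exact => //.
  by rewrite (dvdz_congr (dvdz_exp_le lt_e xy)) vp_dvd.
by rewrite (dvdz_congr (dvdz_exp_le lt_e' xy)) vp_dvd // ltnn.
Qed.

Lemma dvdz_horner (f : {poly int}) a b : (a - b %| f.[a] - f.[b])%Z.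
Proof.
elim/poly_ind: f => [|f c IHf]; first by rewrite !horner0 subrr dvdz0.
rewrite !hornerMXaddC.
have -> : f.[a] * a + c - (f.[b] * b + c) = (f.[a] - f.[b]) * a + f.[b] * (a - b) by ring.
by apply: rpredD; [apply: dvdz_mulr | apply: dvdz_mull].
Qed.

Lemma horner_congr (f : {poly int}) d a b : (d %| a - b)%Z -> (d %| f.[a] - f.[b])%Z.
Proof. by move=> dab; apply: dvdz_trans dab (dvdz_horner f a b). Qed.

Lemma horner_taylor2 (f : {poly int}) a h :
  exists r, f.[a + h] = f.[a] + f^`().[a] * h + r * h ^+ 2.
Proof.
elim/poly_ind: f => [|f c [r fE]]; first by exists 0; rewrite deriv0 !horner0; ring.
exists (f^`().[a] + r * a + r * h).
by rewrite derivMXaddC hornerD hornerMX !hornerMXaddC fE; ring.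
Qed.

(** Newton lifting reaches order at least [m]. If the order is too large, a shift by the [m]-th
    power of [p] brings it to exactly [m], the derivative being a unit. *)
Lemma hensel p (f : {poly int}) a m : prime p -> (p%:Z %| f.[a])%Z ->
  ~~ (p%:Z %| f^`().[a])%Z -> (0 < m)%N ->
  exists b, [/\ (p%:Z %| b - a)%Z, f.[b] != 0 & vp p f.[b] = m].
Proof.
move=> p_pr fa f'a; pose P := p%:Z.
have f'b b : (P %| b - a)%Z -> ~~ (P %| f^`().[b])%Z.
  by move=> ba; rewrite (dvdz_congr (horner_congr _ ba)).
have lift k : exists b, (P %| b - a)%Z /\ (P ^+ k.+1 %| f.[b])%Z.
  elim: k => [|k [b [ba /dvdzP[t ft]]]].
    by exists a; rewrite subrr dvdz0 expr1.
  have cop : coprimez f^`().[b] P.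
    by rewrite coprimezE coprime_sym prime_coprime // -dvdzE f'b.
  have [[u w] uw] := coprimezP _ _ cop;
    have [r fE] := horner_taylor2 f b (P ^+ k.+1 * (- t * u)).
  (* Newton correction: [u] is an inverse of the derivative at [b] modulo [P]. *)
  exists (b + P ^+ k.+1 * (- t * u)); split.
    rewrite -addrA addrC -addrA; apply: rpredD; first by rewrite exprS -!mulrA dvdz_mulr.
    by rewrite addrC.
  rewrite fE ft.
  have -> : t * P ^+ k.+1 + f^`().[b] * (P ^+ k.+1 * (- t * u)) + r * (P ^+ k.+1 * (- t *
    u)) ^+ 2
      = P ^+ k.+1 * (t * (1 - u * f^`().[b]) + r * (- t * u) ^+ 2 * P ^+ k.+1) by ring.
  rewrite [P ^+ k.+2]exprSr; apply: dvdz_mul => //; apply: rpredD.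
    by rewrite -uw /= addrAC subrr add0r dvdz_mull // dvdz_mull.
  by apply: dvdz_mull; rewrite exprS dvdz_mulr.
case: m => // m _; have [b [ba fb]] := lift m.
have [fb'|/(vp_exact p_pr fb)[]] := boolP (P ^+ m.+2 %| f.[b])%Z; last by exists b.
exists (b + P ^+ m.+1).
have ba' : (P %| b + P ^+ m.+1 - a)%Z.
  by rewrite addrAC; apply: rpredD => //; rewrite exprS dvdz_mulr.
have [r fE] := horner_taylor2 f b (P ^+ m.+1).
suff [] : f.[b + P ^+ m.+1] != 0 /\ vp p f.[b + P ^+ m.+1] = m.+1 by [].
apply: vp_exact => //; rewrite fE.
  apply: rpredD; last by rewrite expr2 mulrA dvdz_mull.
  by apply: rpredD => //; rewrite dvdz_mull.
have -> : f.[b] + f^`().[b] * P ^+ m.+1 + r * P ^+ m.+1 ^+ 2 =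
    P ^+ m.+1 * f^`().[b] + (f.[b] + P ^+ m.+2 * (r * P ^+ m)) by rewrite !exprS; ring.
rewrite rpredDr; last by apply: rpredD => //; rewrite dvdz_mulr.
by rewrite [P ^+ m.+2]exprSr dvdz_mul2l ?f'b // expf_neq0 // eqz_nat -lt0n prime_gt0.
Qed.

Lemma nonroot_progression (R : idomainType) (g : {poly R}) (u : nat -> R) :
  injective u -> g != 0 -> exists n, g.[u n] != 0.
Proof.
move=> u_inj g0; apply: NNPP => nog.
have := @max_poly_roots R g (mkseq u (size g)) g0.
rewrite size_mkseq ltnn mkseq_uniq // => /(_ _ isT) bad; suff: false by [].
apply: bad; apply/allP => x /mapP[n _ ->]; apply/negPn/negP => gn.
by apply: nog; exists n.
Qed.

Lemma nonroot_congr (g : {poly int}) a q : q != 0 -> g != 0 ->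
  exists2 b, g.[b] != 0 & (q %| b - a)%Z.
Proof.
move=> q0 g0; have [|n gn] := @nonroot_progression _ g (fun n => a + n%:Z * q) _ g0.
  by move=> m n /addrI/(mulIf q0) [].
by exists (a + n%:Z * q) => //; rewrite addrAC subrr add0r dvdz_mull.
Qed.

(** Euclid's argument: at a multiple [x] of [c * M!], with [c] the constant term, the value is [c]
    times an integer congruent to 1 modulo [M!], whose prime divisors exceed [M]. *)
Lemma prime_divisor_value (f : {poly int}) M : (1 < size f)%N ->
  exists p x, [/\ prime p, (M < p)%N & (p%:Z %| f.[x])%Z].
Proof.
move=> f_gt1; have [p0 Mp0 p0_pr] := prime_above M.
have root_case x : f.[x] = 0 -> exists p x, [/\ prime p, (M < p)%N & (p%:Z %| f.[x])%Z].
  by move=> fx; exists p0, x; rewrite fx dvdz0.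
set c := f.[0]; have [/root_case//|c0] := eqVneq c 0.
have neqC d : f - d%:P != 0.
  rewrite subr_eq0; apply: contraTneq f_gt1 => ->.
  by rewrite size_polyC; case: (d == 0).
(* Avoiding the values [c] and [- c] ensures that the cofactor is not 1 or -1. *)
have q0 : c * M`!%:Z != 0 by rewrite mulf_neq0 // eqz_nat -lt0n fact_gt0.
have [x] := nonroot_congr 0 q0 (mulf_neq0 (neqC c) (neqC (- c))).
rewrite hornerM !hornerD !hornerN !hornerC opprK mulf_eq0 negb_or subr_eq0 addr_eq0.
move=> /andP[fc fNc]; rewrite subr0 => /dvdzP[y xE].
have /dvdzP[k fx] := dvdz_horner f x 0.
pose z := 1 + y * k * M`!%:Z.
have fxz : f.[x] = c * z.
  by rewrite -[f.[x]](subrK c) -/c fx subr0 xE /z; ring.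
have [/root_case//|fx0] := eqVneq f.[x] 0.
have z0 : z != 0 by apply: contraNneq fx0 => z0; rewrite fxz z0 mulr0.
have z1 : (1 < `|z|)%N.
  rewrite ltn_neqAle eq_sym absz_gt0 z0 andbT; apply/negP => /eqP z1.
  have [zE|zE] : z = 1 \/ z = -1 by lia.
    by move/eqP: fc; apply; rewrite fxz zE mulr1.
  by move/eqP: fNc; apply; rewrite fxz zE mulrN1.
exists (pdiv `|z|), x; have p_pr := pdiv_prime z1; split=> //; last first.
  by rewrite fxz dvdz_mull // dvdzE pdiv_dvd.
rewrite ltnNge; apply/negP => pM.
have pz : ((pdiv `|z|)%:Z %| z)%Z by rewrite dvdzE pdiv_dvd.
have : ((pdiv `|z|)%:Z %| 1)%Z.
  rewrite -(@dvdz_congr _ z) // /z addrC addKr dvdz_mull //.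
  by rewrite dvdzE /= dvdn_fact // pM pdiv_gt0.
by rewrite dvdz1 /= => /eqP p1; rewrite p1 in p_pr.
Qed.

Lemma coprimep_bezout (f g : {poly int}) : coprimep f g ->
  exists u w d, d != 0 /\ u * f + w * g = d%:P.
Proof.
move=> /Pdiv.Idomain.Bezout_coprimepP[[u w] /=];
  rewrite -size_poly_eq1 => /size_poly1P[d d0 E].
by exists u, w, d.
Qed.

Lemma dvdz_lt (p : nat) z : z != 0 -> (`|z| < p)%N -> ~~ (p%:Z %| z)%Z.
Proof.
by move=> z0 zp; rewrite dvdzE /=; apply/negP => /dvdn_leq;
  rewrite absz_gt0 z0 leqNgt zp => /(_ isT).
Qed.

Lemma choose_fun (T U : Type) (R : T -> U -> Prop) :
  (forall x, exists y, R x y) -> exists f, forall x, R x (f x).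
Proof.
move=> ex; exists (fun x => proj1_sig (constructive_indefinite_description _ (ex x))) => x.
exact: (proj2_sig (constructive_indefinite_description _ (ex x))).
Qed.

(** On integer polynomials [%|] and [%=] ignore nonzero integer factors, so irreducibility here is
    irreducibility over the rationals. *)
Lemma irreducible_coprime (f g : {poly int}) : irreducible_poly f -> irreducible_poly g ->
  coprimep f g \/ f %= g.
Proof.
move=> f_irr g_irr; have [|ncop] := boolP (coprimep f g); [by left | right].
have sz : size (gcdp f g) != 1 by rewrite -coprimep_def.
have := f_irr.2 _ sz (dvdp_gcdl f g); rewrite eqp_sym => fd.
exact: eqp_trans fd (g_irr.2 _ sz (dvdp_gcdr f g)).
Qed.

(** In characteristic 0 the derivative of a nonconstant polynomial is nonzero, and its degree is too
    small for [f] to divide it. *)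
Lemma irreducible_coprime_deriv (f : {poly int}) : irreducible_poly f -> coprimep f f^`().
Proof.
move=> f_irr; have f_gt1 := f_irr.1; have f0 := irredp_neq0 f_irr.
have f'0 : f^`() != 0.
  apply/eqP => /(congr1 (fun g : {poly int} => g`_(size f).-2)).
  rewrite coef_deriv coef0; move: f_gt1; case sf: (size f) => [|[|n]] //= _ /eqP.
  rewrite mulrn_eq0 /= => /eqP lf; have := lead_coef_eq0 f;
    rewrite /lead_coef sf /= lf eqxx.
  by rewrite (negPf f0).
rewrite coprimep_def; apply/negPn/negP => sz.
have := f_irr.2 _ sz (dvdp_gcdl f f^`()) => /eqp_size szf.
have := dvdp_leq f'0 (dvdp_gcdr f f^`()); rewrite szf leqNgt.
by rewrite lt_size_deriv.
Qed.

Definition coprime_to (f : {poly int}) (L : seq {poly int}) :=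
  forall g, g \in L -> coprimep f g.

Lemma coprime_prod f L : coprime_to f L -> coprimep f (\prod_(g <- L) g).
Proof.
elim: L => [|g L IHL] fL; first by rewrite big_nil coprimep1.
rewrite big_cons Pdiv.Idomain.coprimepMr fL ?mem_head ?IHL // => h hL.
by apply: fL; rewrite inE hL orbT.
Qed.

Lemma dvdz_prod_horner d x (L : seq {poly int}) g : g \in L ->
  (d %| g.[x])%Z -> (d %| (\prod_(h <- L) h).[x])%Z.
Proof. by move=> gL dg; rewrite (big_rem g) //= hornerM dvdz_mulr. Qed.

(* A large prime does not divide the Bezout constant of f and f' * \prod_(g <- L) g. *)
Lemma simple_root_prime f L M : irreducible_poly f -> coprime_to f L ->
  exists p a, [/\ prime p, (M < p)%N, (p%:Z %| f.[a])%Z, ~~ (p%:Z %| f^`().[a])%Z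
    & forall g, g \in L -> ~~ (p%:Z %| g.[a])%Z].
Proof.
move=> f_irr fL; set F := f^`() * \prod_(g <- L) g.
have : coprimep f F.
  by rewrite Pdiv.Idomain.coprimepMr irreducible_coprime_deriv //= coprime_prod.
move=> /coprimep_bezout[u [w [d [d0 E]]]].
have [p [a [p_pr Mp pf]]] := prime_divisor_value (maxn M `|d|) f_irr.1.
move: Mp; rewrite gtn_max => /andP[Mp dp].
have pF : ~~ (p%:Z %| F.[a])%Z.
  apply: contra (dvdz_lt d0 dp) => pF.
  have -> : d = (d%:P).[a] by rewrite hornerC.
  by rewrite -E hornerD [(u * f).[a]]hornerM [(w * F).[a]]hornerM; apply: rpredD;
    apply: dvdz_mull.
exists p, a; split=> // [|g gL]; apply: contra pF => pF; rewrite /F hornerM.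
  exact: dvdz_mulr.
by apply: dvdz_mull; apply: dvdz_prod_horner pF.
Qed.

Definition wt (i : 'I_4) : int := nth 0 [:: 2; 3; -1; -4] i.

(** * Finite approximations *)

(* The n-th prime is pp n; al n i is known modulo (pp n) ^ ee, and dm n is a residue
   class avoided by all al n i. *)
Record state := State {
  np : nat; pp : nat -> nat; al : nat -> 'I_4 -> int; dm : nat -> int; ee : nat }.

Implicit Types (st : state) (L : seq {poly int}).

(** [st_frozen] keeps the valuations of [L] below the precision, so refinement cannot change them.
    [st_sep] and [st_dummy] let a linear polynomial vanish at exactly one of the four places of a
    prime, or at none. *)
Record valid L st : Prop := Valid {
  st_prime : forall n, (n < np st)%N -> prime (pp st n);
  st_neq : forall m n, (m < np st)%N -> (n < np st)%N -> m != n -> pp st m != pp st n;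
  st_sep : forall n i j, (n < np st)%N -> i != j ->
    ~~ ((pp st n)%:Z %| al st n i - al st n j)%Z;
  st_dummy : forall n i, (n < np st)%N -> ~~ ((pp st n)%:Z %| al st n i - dm st n)%Z;
  st_ee : (0 < ee st)%N;
  st_frozen : forall g n i, g \in L -> (n < np st)%N ->
    ~~ ((pp st n)%:Z ^+ ee st %| g.[al st n i])%Z }.

(** The degree of the divisor of [g] over the primes built so far. *)
Definition defect st (g : {poly int}) : int :=
  \sum_(n < np st) \sum_i wt i * (vp (pp st n) g.[al st n i])%:Z.

Record extends L st st' : Prop := Extends {
  ext_np : (np st <= np st')%N;
  ext_pp : forall n, (n < np st)%N -> pp st' n = pp st n;
  ext_al : forall n i, (n < np st)%N -> ((pp st n)%:Z ^+ ee st %| al st' n i - al st n i)%Z;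
  ext_ee : (ee st <= ee st')%N;
  ext_new : forall g n i, g \in L -> (np st <= n < np st')%N ->
    ~~ ((pp st' n)%:Z %| g.[al st' n i])%Z }.

Lemma extends_refl L st : extends L st st.
Proof. by split=> // [n i _|g n i _]; [rewrite subrr dvdz0 | lia]. Qed.

Lemma extends_trans L L' st1 st2 st3 : {subset L <= L'} -> (0 < ee st2)%N ->
  extends L st1 st2 -> extends L' st2 st3 -> extends L st1 st3.
Proof.
move=> LL' e2 [np12 pp12 al12 ee12 new12] [np23 pp23 al23 ee23 new23]; split.
- exact: leq_trans np23.
- by move=> n n1; rewrite pp23 ?pp12 //; apply: leq_trans np12.
- move=> n i n1; rewrite -[al st3 n i](subrK (al st2 n i)) -addrA.
  apply: rpredD (al12 n i n1); rewrite -pp12 //; apply: dvdz_exp_le ee12 _.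
  by apply: al23; apply: leq_trans np12.
- exact: leq_trans ee23.
move=> g n i gL /andP[n1 n3]; have [n2|n2] := ltnP n (np st2); last first.
  by apply: new23; [apply: LL' | rewrite n2].
rewrite pp23 // (@dvdz_congr _ _ g.[al st2 n i]); first by apply: new12; rewrite ?n1.
apply: horner_congr; rewrite -[Posz _]expr1.
exact: dvdz_exp_le e2 (al23 n i n2).
Qed.

Lemma dvdz_exp1 (p : int) e z : (0 < e)%N -> (p ^+ e %| z)%Z -> (p %| z)%Z.
Proof. by move=> e0 pz; rewrite -[p]expr1; apply: dvdz_exp_le pz. Qed.

Lemma frozen_congr (p : int) e e' (g : {poly int}) a a' : (e <= e')%N ->
  (p ^+ e %| a' - a)%Z -> ~~ (p ^+ e %| g.[a])%Z -> ~~ (p ^+ e' %| g.[a'])%Z.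
Proof.
move=> ee aa; apply: contra => /(dvdz_exp_le ee).
by rewrite (dvdz_congr (horner_congr g aa)).
Qed.

Section Extension.
Variables (L L' : seq {poly int}) (st st' : state).
Hypotheses (V : valid L st) (V' : valid L' st') (E : extends L st st').

Lemma extends_vp g n i : g \in L -> (n < np st)%N ->
  g.[al st' n i] != 0 /\ vp (pp st' n) g.[al st' n i] = vp (pp st n) g.[al st n i].
Proof.
move=> gL lt_n; rewrite (ext_pp E) //; apply: (@vp_congr _ (ee st)).
- exact: (st_prime V lt_n).
- by apply: horner_congr; exact: (ext_al E i lt_n).
- exact: (st_frozen V i gL lt_n).
Qed.

Lemma extends_vp_new g n i : g \in L -> (np st <= n < np st')%N ->
  vp (pp st' n) g.[al st' n i] = 0%N.
Proof.
move=> gL nn; apply: vp_eq0; last exact: (ext_new E i gL nn).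
by case/andP: nn => _; exact: (st_prime V').
Qed.

(** Old valuations are frozen and new primes avoid [L]. *)
Lemma extends_defect g : g \in L -> defect st' g = defect st g.
Proof.
move=> gL; rewrite /defect.
rewrite -(big_mkord xpredT (fun n => \sum_i wt i * (vp (pp st' n) g.[al st' n i])%:Z)).
rewrite (big_cat_nat _ (ext_np E)) //= [X in _ + X]big_nat [X in _ + X]big1 ?addr0 =>
  [|n nn].
  rewrite big_mkord; apply: eq_bigr => n _; apply: eq_bigr => i _.
  by have [_ ->] := extends_vp i gL (ltn_ord n).
by rewrite big1 // => i _; rewrite extends_vp_new ?mulr0.
Qed.

End Extension.

(** Each [al st n i] moves inside its residue class off the roots of [f]; the precision then rises
    above all resulting valuations of [f]. *)
Lemma refine L st f : valid L st -> f != 0 ->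
  exists st', [/\ valid (f :: L) st', extends L st st' & np st' = np st].
Proof.
move=> V f0; have pn0 n : (n < np st)%N -> (pp st n)%:Z ^+ ee st != 0.
  by move=> lt_n; rewrite expf_neq0 // eqz_nat -lt0n prime_gt0 // (st_prime V).
have [a aP] : exists a : nat * 'I_4 -> int, forall x, f.[a x] != 0 /\
    ((x.1 < np st)%N -> ((pp st x.1)%:Z ^+ ee st %| a x - al st x.1 x.2)%Z).
  apply: (@choose_fun _ _ (fun x a => f.[a] != 0 /\
    ((x.1 < np st)%N -> ((pp st x.1)%:Z ^+ ee st %| a - al st x.1 x.2)%Z))) => -[n i] /=.
  have [lt_n|_] := ltnP n (np st).
    by have [a fa na] := nonroot_congr (al st n i) (pn0 n lt_n) f0; exists a.
  by have [a fa _] := nonroot_congr 0 (oner_neq0 int) f0; exists a.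
pose e := (ee st + (\sum_(n < np st) \sum_i vp (pp st n) f.[a (val n, i)]).+1)%N.
have al_congr n i : (n < np st)%N -> ((pp st n)%:Z ^+ ee st %| a (n, i) - al st n i)%Z.
  by move=> lt_n; apply: (aP (n, i)).2.
have al_congr1 n i : (n < np st)%N -> ((pp st n)%:Z %| a (n, i) - al st n i)%Z.
  by move=> lt_n; apply: dvdz_exp1 (st_ee V) (al_congr n i lt_n).
exists (State (np st) (pp st) (fun n i => a (n, i)) (dm st) e); split=> //; split=> //=.
- exact: (st_prime V).
- exact: (st_neq V).
- move=> n i j lt_n ij; rewrite (@dvdz_congr _ _ (al st n i - al st n j)) ?(st_sep V) //.
  have -> : a (n, i) - a (n, j) - (al st n i - al st n j) =
    (a (n, i) - al st n i) - (a (n, j) - al st n j) by ring.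
  by apply: rpredB; apply: al_congr1.
- move=> n i lt_n; rewrite (@dvdz_congr _ _ (al st n i - dm st n)) ?(st_dummy V) //.
  have -> : a (n, i) - dm st n - (al st n i - dm st n) = a (n, i) - al st n i by ring.
  exact: al_congr1.
- by rewrite /e addnS.
- move=> g n i; rewrite inE => /orP[/eqP->|gL] lt_n; last first.
    apply: frozen_congr (st_frozen V i gL lt_n); last exact: al_congr.
    by rewrite /e leq_addr.
  rewrite vp_dvd ?(st_prime V) //; last exact: (aP (n, i)).1.
  rewrite -ltnNge /e (bigD1 (Ordinal lt_n)) //= (bigD1 i) //=; lia.
- by rewrite /e leq_addr.
- by move=> g n i _; rewrite leqNgt => /andP[/negPf->].
Qed.

Lemma nonroot_window (F : {poly int}) m : F != 0 ->
  exists t : int, forall k, (k < m)%N -> F.[t + k%:Z] != 0.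
Proof.
move=> F0; have G0 : \prod_(k < m) (F \Po ('X + (k%:Z)%:P)) != 0.
  apply/prodf_neq0 => k _; rewrite -size_poly_gt0 size_comp_poly2 ?size_poly_gt0 //.
  by rewrite size_XaddC.
have [t Gt _] := nonroot_congr 0 (oner_neq0 int) G0; exists t => k lt_k.
move: Gt; rewrite horner_prod => /prodf_neq0/(_ (Ordinal lt_k) isT) /=.
by rewrite horner_comp hornerD hornerX hornerC.
Qed.

(* The residues t + k of the places where f must not vanish are chosen first; the new
   prime exceeds all values of f and L there, hence also separates them from the root of
   f. *)
Lemma add_prime L st f i0 m : valid (f :: L) st -> irreducible_poly f -> coprime_to f L ->
  (0 < m)%N -> exists st', [/\ valid (f :: L) st', extends L st st',
    np st' = (np st).+1 & defect st' f = defect st f + wt i0 * m%:Z].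
Proof.
move=> V f_irr fL m0; set F := \prod_(g <- f :: L) g.
have L_neq0 g : g \in L -> g != 0.
  move=> gL; apply: contraTneq (fL g gL) => ->.
  by rewrite coprimep0 -size_poly_eq1; case: f_irr.1; case: (size f) => [|[]].
have F0 : F != 0.
  rewrite /F prodf_seq_neq0; apply/allP => g; rewrite inE => /orP[/eqP->|/L_neq0->//].
  exact: irredp_neq0.
(* Offsets 0 to 3 are for the four places, one of which takes the root [b] instead; offset 4 is the
   dummy residue. *)
have [t tF] := nonroot_window 5 F0.
(* The term 5 keeps the five residues distinct modulo [p], and the sum of the old primes makes [p]
   new. *)
pose M := (5 + \sum_(k < 5) `|F.[t + k%:Z]| + \sum_(n < np st) pp st n)%N.
have [p [a [p_pr Mp pf pf' pL]]] := simple_root_prime M f_irr fL.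
have [b [ba fb0 fbm]] := hensel p_pr pf pf' m0.
have pF k : (k < 5)%N -> ~~ (p%:Z %| F.[t + k%:Z])%Z.
  move=> lt_k; apply: dvdz_lt (tF k lt_k) _; apply: leq_ltn_trans Mp.
  rewrite /M (bigD1 (Ordinal lt_k)) //=; apply: leq_trans (leq_addr _ _).
  by apply: leq_trans (leq_addl _ _); apply: leq_addr.
have pgt g k : g \in f :: L -> (k < 5)%N -> ~~ (p%:Z %| g.[t + k%:Z])%Z.
  by move=> gL lt_k; apply: contra (pF k lt_k); apply: dvdz_prod_horner.
have pfb : (p%:Z %| f.[b])%Z by rewrite (dvdz_congr (horner_congr f ba)).
have pbt k : (k < 5)%N -> ~~ (p%:Z %| b - (t + k%:Z))%Z.
  move=> lt_k; apply/negP => /(horner_congr f)/dvdz_congr; rewrite pfb => /esym pft.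
  by have := pgt f k (mem_head _ _) lt_k; rewrite pft.
have p5 : (5 < p)%N by apply: leq_ltn_trans Mp; rewrite /M -addnA leq_addr.
have ptt k l : (k < 5)%N -> (l < 5)%N -> k != l -> ~~ (p%:Z %| t + k%:Z - (t + l%:Z))%Z.
  by move=> k5 l5 kl; apply: dvdz_lt; lia.
pose al' n (i : 'I_4) :=
  if n == np st then (if i == i0 then b else t + (val i)%:Z) else al st n i.
pose pp' n := if n == np st then p else pp st n.
pose dm' n := if n == np st then t + 4%:Z else dm st n.
have old n : (n < np st)%N -> (n == np st) = false by move=> lt_n; rewrite ltn_eqF.
have ppM n : (n < np st)%N -> (pp st n < p)%N.
  move=> lt_n; apply: leq_ltn_trans Mp; rewrite /M.
  rewrite [X in (_ <= _ + X)%N](bigD1 (Ordinal lt_n)) //=.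
  by apply: leq_trans (leq_addl _ _); apply: leq_addr.
have i4 (i : 'I_4) : (val i < 5)%N by apply: ltn_trans (ltn_ord i) _.
exists (State (np st).+1 pp' al' dm' (ee st + m.+1)%N); split=> //.
- split=> /=.
  + by move=> n; rewrite ltnS leq_eqVlt /pp' => /orP[->//|/[dup]/old->];
    exact: (st_prime V).
  + move=> k n; rewrite !ltnS [(k <= _)%N]leq_eqVlt [(n <= _)%N]leq_eqVlt /pp' =>
    /orP[/eqP->|kn] /orP[/eqP->|nn]; rewrite ?eqxx //.
    * by rewrite old // => _; rewrite gtn_eqF ?ppM.
    * by rewrite old // => _; rewrite ltn_eqF ?ppM.
    * by rewrite !old //; exact: (st_neq V).
  + move=> n i j; rewrite ltnS leq_eqVlt /pp' /al' => /orP[->|nn] ij; last first.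
      by rewrite old //; exact: (st_sep V nn ij).
    have [ii|ii] := eqVneq i i0; have [jj|jj] := eqVneq j i0.
    * by rewrite ii jj eqxx in ij.
    * exact: pbt.
    * by rewrite -opprB rpredN; apply: pbt.
    * by apply: ptt.
  + move=> n i; rewrite ltnS leq_eqVlt /pp' /al' /dm' => /orP[->|nn]; last first.
      by rewrite old //; exact: (st_dummy V i nn).
    have [ii|ii] := eqVneq i i0; first exact: pbt.
    by apply: ptt; rewrite ?(ltn_eqF (ltn_ord i)).
  + by rewrite addn_gt0 orbT.
  + move=> g n i gL; rewrite ltnS leq_eqVlt /pp' /al' => /orP[->|nn]; last first.
      rewrite old //; apply: contra (st_frozen V i gL nn); apply: dvdz_exp_le.
      exact: leq_addr.
    have [_|_] := eqVneq i i0; last first.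
      by apply: contra (pgt g _ gL (i4 i)); apply: dvdz_exp1; rewrite addnS.
    move: gL; rewrite inE => /orP[/eqP->|gL].
      by rewrite vp_dvd // fbm -ltnNge; lia.
    apply: contra (pL g gL) => /(@dvdz_exp1 _ _ _ _) pg.
    by rewrite -(dvdz_congr (horner_congr g ba)) pg ?addnS.
- split=> /=; rewrite ?leq_addr //.
  + by move=> n nn; rewrite /pp' old.
  + by move=> n i nn; rewrite /al' old // subrr dvdz0.
  + move=> g n i gL /andP[nn1 nn2]; have nE : n = np st by lia.
    rewrite nE /pp' /al' eqxx; have [_|_] := eqVneq i i0.
      by rewrite (dvdz_congr (horner_congr g ba)) pL.
    by apply: pgt => //; rewrite inE gL orbT.
- rewrite /defect /= big_ord_recr /=; congr (_ + _).
    apply: eq_bigr => n _; apply: eq_bigr => i _.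
    by rewrite /pp' /al' old.
  rewrite (bigD1 i0) //= /pp' /al' !eqxx fbm big1 ?addr0 // => i /negPf->.
  by rewrite vp_eq0 ?mulr0 // pgt ?mem_head.
Qed.

(** * Giving irreducible polynomials degree 0 and realizing linear divisors *)

Record good L st : Prop := Good {
  good_valid : valid L st;
  good_irr : forall g, g \in L -> irreducible_poly g;
  good_defect : forall g, g \in L -> defect st g = 0 }.

Lemma good_extends L st f st' : good L st -> irreducible_poly f -> valid (f :: L) st' ->
  extends L st st' -> defect st' f = 0 -> good (f :: L) st'.
Proof.
move=> [V irr def0] f_irr V' E def'; split=> // g; rewrite inE => /orP[/eqP->//|gL].
  exact: irr.
by rewrite (extends_defect V V' E) ?def0.
Qed.

(* Hitting f first at a place of class 2 makes its defect positive; a place of class -1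
   then cancels it. *)
Lemma step_irreducible L st f : good L st -> irreducible_poly f -> coprime_to f L ->
  exists st', [/\ good (f :: L) st', extends L st st' & (np st < np st')%N].
Proof.
move=> G f_irr fL; have V := good_valid G.
have [st1 [V1 E1 np1]] := refine V (irredp_neq0 f_irr).
pose s := defect st1 f; pose m := `|s|%N.+1.
have [|st2 [V2 E2 np2 d2]] := @add_prime L st1 f ord0 m V1 f_irr fL; first by [].
pose m' := absz (s + 2 * m%:Z).
have [|st3 [V3 E3 np3 d3]] := @add_prime L st2 f (inord 2) m' V2 f_irr fL.
  by rewrite /m' /m; lia.
have E13 : extends L st1 st3 by apply: extends_trans E2 E3; rewrite // (st_ee V2).
have E : extends L st st3 by apply: extends_trans E1 E13; rewrite // (st_ee V1).
exists st3; split=> //; last by rewrite np3 np2 np1.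
apply: good_extends G f_irr V3 E _.
by rewrite d3 d2 -/s /wt inordK //= /m' /m; lia.
Qed.

Lemma linear_coprime L b : (forall g, g \in L -> g.[b] != 0) -> coprime_to ('X - b%:P) L.
Proof.
by move=> Lb g gL; rewrite coprimep_sym Pdiv.Idomain.coprimep_XsubC rootE Lb.
Qed.

Lemma good_prod_neq0 L st : good L st -> \prod_(g <- L) g != 0.
Proof.
move=> G; rewrite prodf_seq_neq0; apply/allP => g gL /=.
exact: irredp_neq0 (good_irr G gL).
Qed.

Lemma prod_nonroot L b : (\prod_(g <- L) g).[b] != 0 -> forall g, g \in L -> g.[b] != 0.
Proof.
move=> Lb g gL; apply: contraNneq Lb => gb.
by rewrite (big_rem g) //= hornerM gb mul0r.
Qed.

(** Each linear polynomial coprime to the list forces at least one further prime when it is given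
    degree 0. *)
Lemma grow L st N : good L st ->
  exists L' st', [/\ good L' st', {subset L <= L'}, extends L st st' & (N <= np st')%N].
Proof.
move=> G; elim: N => [|N [L1 [st1 [G1 L1s E1 N1]]]].
  by exists L, st; split=> //; apply: extends_refl.
have [b bL _] := nonroot_congr 0 (oner_neq0 int) (good_prod_neq0 G1).
have [st2 [G2 E2 np2]] := step_irreducible G1 (Pdiv.Idomain.irredp_XsubC b)
  (linear_coprime (prod_nonroot bL)).
exists ('X - b%:P :: L1), st2; split=> //; last by apply: leq_ltn_trans np2.
  by move=> g /L1s; rewrite inE orbC => ->.
by apply: extends_trans L1s _ E1 E2; apply: st_ee (good_valid G1).
Qed.

Lemma chinese_seq N (q r : nat -> int) :
  (forall m n, (m < N)%N -> (n < N)%N -> m != n -> coprimez (q m) (q n)) ->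
  exists b, forall n, (n < N)%N -> (q n %| b - r n)%Z.
Proof.
elim: N => [|N IHN] cop; first by exists 0.
have [|b bP] := IHN; first by move=> m n mN nN; apply: cop; apply: ltnW.
have copN : coprimez (\prod_(n < N) q n) (q N).
  elim/big_ind: _ => [|x y xN yN|n _]; first by rewrite coprimezE coprime1n.
    by rewrite coprimezMl xN.
  by apply: cop; [rewrite ltnS ltnW | | rewrite ltn_eqF].
have [[u w] /= uw] := coprimezP _ _ copN.
set Q := \prod_(n < N) q n in uw.
exists (b + (r N - b) * u * Q) => n; rewrite ltnS leq_eqVlt => /orP[/eqP->|nN].
  have -> : b + (r N - b) * u * Q - r N = (b - r N) * (1 - u * Q) by ring.
  by rewrite -uw addrAC subrr add0r dvdz_mull // dvdz_mull.
rewrite addrAC; apply: rpredD; first exact: bP.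
by apply: dvdz_mull; rewrite /Q (bigD1 (Ordinal nN)) //= dvdz_mulr.
Qed.

(* A target prescribes at the n-th prime one place and the order of vanishing there, so
   that the Chinese remainder theorem provides a linear polynomial with that divisor. *)
Definition target (s : seq ('I_4 * nat)) n : 'I_4 * nat := nth (ord0, 0%N) s n.

Definition target_at s n i : nat := if i == (target s n).1 then (target s n).2 else 0%N.

Definition target_degree s N : int :=
  \sum_(n < N) wt (target s n).1 * (target s n).2%:Z.

Lemma step_relation L st s : good L st -> target_degree s (np st) = 0 ->
  exists st' b, [/\ good ('X - b%:P :: L) st', extends L st st', np st' = np st
    & forall n i, (n < np st)%N -> vp (pp st' n) (al st' n i - b) = target_at s n i].
Proof.
move=> G sdeg; have V := good_valid G.
pose m n := (target s n).2; pose i_ n := (target s n).1.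
pose e := (ee st + (\sum_(n < np st) m n).+1)%N.
have m_lt n : (n < np st)%N -> (m n < e)%N.
  move=> nN; rewrite /e addnS ltnS; apply: leq_trans (leq_addl _ _).
  by rewrite (bigD1 (Ordinal nN)) //= leq_addr.
(* Modulo the next power of the prime, [b] differs from the targeted root by exactly its [m n]-th
   power. When nothing is prescribed, the dummy residue keeps [b] away from all four places. *)
pose r n := if m n == 0%N then dm st n else al st n (i_ n) + (pp st n)%:Z ^+ m n.
pose q n := (pp st n)%:Z ^+ (m n).+1.
have [|b0 b0P] := @chinese_seq (np st) q r.
  move=> k n kN nN kn; rewrite coprimezE !abszX /= coprimeXl // coprimeXr //.
  by rewrite prime_coprime ?(st_prime V) // dvdn_prime2 ?(st_prime V) // (st_neq V).
have Q0 : \prod_(n < np st) q n != 0.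
  apply/prodf_neq0 => n _; rewrite expf_neq0 // eqz_nat -lt0n prime_gt0 //.
  exact: (st_prime V).
have [b bL bb0] := nonroot_congr b0 Q0 (good_prod_neq0 G).
have bP n : (n < np st)%N -> (q n %| b - r n)%Z.
  move=> nN; have -> : b - r n = (b - b0) + (b0 - r n) by ring.
  apply: rpredD; last exact: b0P.
  by apply: dvdz_trans bb0; rewrite (bigD1 (Ordinal nN)) //= dvdz_mulr.
have vb n i : (n < np st)%N ->
  al st n i - b != 0 /\ vp (pp st n) (al st n i - b) = target_at s n i.
  move=> nN; have p_pr := st_prime V nN; have := bP n nN; rewrite /q /r => bn.
  have bn1 := dvdz_exp1 (ltn0Sn _) bn.
  have notp x : ~~ ((pp st n)%:Z %| al st n i - x)%Z -> ((pp st n)%:Z %| b - x)%Z ->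
      al st n i - b != 0 /\ vp (pp st n) (al st n i - b) = 0%N.
    move=> ax bx; apply: vp_exact => //; rewrite ?expr0 ?dvd1z // expr1.
    apply: contra ax => ab; have -> : al st n i - x = (al st n i - b) + (b - x) by ring.
    exact: rpredD.
  rewrite /target_at -/(i_ n) -/(m n); move: bn bn1;
    have [mn bn bn1|mn bn bn1] := eqVneq (m n) 0%N.
    by rewrite mn if_same; apply: notp bn1; apply: st_dummy V _ _ nN.
  have pm : ((pp st n)%:Z %| (pp st n)%:Z ^+ m n)%Z by rewrite -(prednK (_ : 0 < m n)%N)
    ?lt0n // exprS dvdz_mulr.
  have [ii|ii] := eqVneq i (i_ n); last first.
    apply: notp (st_sep V nN ii) _.
    have -> : b - al st n (i_ n) =
      b - (al st n (i_ n) + (pp st n)%:Z ^+ m n) + (pp st n)%:Z ^+ m n by ring.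
    exact: rpredD.
  have E : al st n i - b = - ((pp st n)%:Z ^+ m n + (b - (al st n i + (pp st n)%:Z ^+ m
    n))) by ring.
  rewrite -ii in bn; apply: vp_exact => //; rewrite E rpredN.
    by apply: rpredD => //; apply: dvdz_exp_le bn.
  have p0 : (pp st n)%:Z != 0 by rewrite eqz_nat -lt0n prime_gt0.
  by rewrite rpredDr // vp_dvd ?expf_neq0 // /vp abszX pfactorK ?ltnn.
pose st' := State (np st) (pp st) (al st) (dm st) e.
have E : extends L st st'.
  split=> //= [n i _||g n i _]; first by rewrite subrr dvdz0.
    by rewrite leq_addr.
  by rewrite leqNgt => /andP[/negPf->].
exists st', b; split=> // [|n i nN]; last by case: (vb n i nN).
have V' : valid ('X - b%:P :: L) st'.
  split=> //=.
  - exact: (st_prime V).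
  - exact: (st_neq V).
  - exact: (st_sep V).
  - exact: (st_dummy V).
  - by rewrite /e addnS.
  move=> g n i; rewrite inE => /orP[/eqP->|gL] nN; last first.
    by apply: contra (st_frozen V i gL nN) => /(dvdz_exp_le (leq_addr _ _)).
  have [ab0 abv] := vb n i nN; rewrite hornerXsubC vp_dvd ?(st_prime V) // abv -ltnNge.
  by rewrite /target_at; case: eqP => _; [apply: m_lt | rewrite /e addnS].
apply: good_extends G (Pdiv.Idomain.irredp_XsubC b) V' E _.
rewrite -[RHS]sdeg; apply: eq_bigr => n _; rewrite (bigD1 (target s n).1) //=.
rewrite big1 ?addr0 => [|i /negPf ii]; rewrite hornerXsubC.
  by rewrite (vb n _ (ltn_ord n)).2 /target_at eqxx.
by rewrite (vb n _ (ltn_ord n)).2 /target_at ii mulr0.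
Qed.

(** * Serving all requests *)

Definition request := ({poly int} + seq ('I_4 * nat))%type.

(** Requests are countable, hence can be served one by one. The bound on [size s] also forces the
    number of primes to grow without limit. *)
Definition served (x : request) L st : Prop :=
  match x with
  | inl f => irreducible_poly f -> exists2 g, g \in L & f %= g
  | inr s => (size s <= np st)%N /\ (target_degree s (size s) = 0 ->
      exists2 b, 'X - b%:P \in L & forall n i, (n < np st)%N ->
        vp (pp st n) (al st n i - b) = target_at s n i)
  end.

Lemma target_degree_size s N : (size s <= N)%N ->
  target_degree s N = target_degree s (size s).
Proof.
move=> sN; rewrite /target_degree.
rewrite -(big_mkord xpredT (fun n => wt (target s n).1 * (target s n).2%:Z)).
rewrite (big_cat_nat _ sN) //= big_mkord [X in _ + X]big_nat [X in _ + X]big1 ?addr0 //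
  => n /andP[sn _].
by rewrite /target nth_default //= mulr0.
Qed.

Lemma step L st x : good L st -> exists L' st',
  [/\ good L' st', {subset L <= L'}, extends L st st' & served x L' st'].
Proof.
move=> G; case: x => [f|s] /=.
- have [f_irr|nirr] := classic (irreducible_poly f); last first.
    by exists L, st; split=> //; apply: extends_refl.
  have [[g gL fg]|nog] := classic (exists2 g, g \in L & f %= g).
    by exists L, st; split=> //; [apply: extends_refl | exists g].
  have fL : coprime_to f L.
    move=> g gL; have [//|fg] := irreducible_coprime f_irr (good_irr G gL).
    by case: nog; exists g.
  have [st' [G' E _]] := step_irreducible G f_irr fL.
  exists (f :: L), st'; split=> // [g gL|_]; first by rewrite inE gL orbT.
  by exists f; rewrite ?mem_head // Pdiv.Idomain.eqpxx.
- have [L1 [st1 [G1 L1s E1 N1]]] := grow (size s) G.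
  have [s0|s0] := eqVneq (target_degree s (size s)) 0; last first.
    by exists L1, st1; split=> //; split=> // s0'; rewrite s0' in s0.
  have [|st2 [b [G2 E2 np2 vb]]] := @step_relation L1 st1 s G1;
    first by rewrite target_degree_size.
  exists ('X - b%:P :: L1), st2; split=> //.
  + by move=> g /L1s; rewrite inE orbC => ->.
  + by apply: extends_trans L1s _ E1 E2; apply: st_ee (good_valid G1).
  + by split=> [|_]; [rewrite np2 | exists b; rewrite ?mem_head // np2].
Qed.

(** Stage [k] serves the request with code [k]. *)
Lemma chain : exists (L : nat -> seq {poly int}) (st : nat -> state),
  [/\ forall k, good (L k) (st k), forall k, {subset L k <= L k.+1},
      forall k, extends (L k) (st k) (st k.+1)
    & forall x : request, exists k, served x (L k) (st k)].
Proof.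
pose T := {x : seq {poly int} * state | good x.1 x.2}.
have [F FP] : exists F : nat * T -> T, forall x,
    [/\ {subset (sval x.2).1 <= (sval (F x)).1},
       extends (sval x.2).1 (sval x.2).2 (sval (F x)).2
     & forall y : request, unpickle x.1 = Some y -> served y (sval (F x)).1 (sval (F x)).2].
  apply: (@choose_fun _ _ (fun (x : nat * T) (z : T) =>
    [/\ {subset (sval x.2).1 <= (sval z).1},
       extends (sval x.2).1 (sval x.2).2 (sval z).2
     & forall y : request, unpickle x.1 = Some y -> served y (sval z).1 (sval z).2])).
  move=> [k [[L st] /= G]].
  (* Numbers that code no request serve the empty target instead. *)
  have [L' [st' [G' Ls E sv]]] := @step L st (odflt (inr [::]) (unpickle k)) G.
  by exists (exist _ (L', st') G'); split=> //= y ky; rewrite ky in sv.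
have G0 : good [::] (State 0 (fun=> 0%N) (fun _ _ => 0) (fun=> 0) 1) by split=> //; split.
pose z := fix z k : T := if k is k'.+1 then F (k', z k') else exist _ ([::], _) G0.
exists (fun k => (sval (z k)).1), (fun k => (sval (z k)).2); split.
- by move=> k; case: (z k).
- by move=> k; have [] := FP (k, z k).
- by move=> k; have [] := FP (k, z k).
- move=> x; exists (pickle x).+1; have [_ _] := FP (pickle x, z (pickle x)).
  by apply; rewrite /= pickleK.
Qed.

(** * Limit valuations *)

Lemma fraction_div (R : idomainType) (x : {fraction R}) :
  exists a b : R, b != 0 /\ x = FracField.tofrac a / FracField.tofrac b.
Proof.
elim/quotW: x => r; exists \n_r, \d_r; split; first exact: denom_ratioP.
apply: (canRL (mulfK _)); first by rewrite tofrac_eq0 denom_ratioP.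
unlock FracField.tofrac; rewrite -[LHS]FracField.pi_mul.
apply/eqmodP; rewrite /= FracField.equivfE /FracField.mulf !numden_Ratio ?mulr1
  ?oner_neq0 ?denom_ratioP //.
by rewrite mulrC.
Qed.

Lemma sum_wt (a : int) : \sum_i wt i * a = 0.
Proof. by rewrite !big_ord_recl big_ord0 /wt /=; ring. Qed.

Lemma wt_neq0 i : wt i != 0.
Proof. by case: i => -[|[|[|[|]]]]. Qed.

Lemma injective_unbounded (P : nat -> nat) M : injective P ->
  exists N, forall n, (N <= n)%N -> (M < P n)%N.
Proof.
move=> P_inj; elim: M => [|M [N NP]].
  have [[n0 P0]|noP] := classic (exists n0, P n0 = 0%N); last first.
    by exists 0%N => n _; rewrite lt0n; apply/eqP => Pn; apply: noP; exists n.
  exists n0.+1 => n lt_n; rewrite lt0n; apply: contraTneq lt_n => Pn.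
  by rewrite -leqNgt (P_inj n n0) ?P0.
have [[n0 P0]|noP] := classic (exists n0, P n0 = M.+1); last first.
  exists N => n /NP; rewrite leq_eqVlt => /orP[/eqP Pn|//].
  by case: noP; exists n.
exists (maxn N n0.+1) => n; rewrite geq_max => /andP[/NP + lt_n].
rewrite leq_eqVlt => /orP[/eqP Pn|//]; move: lt_n.
by rewrite (P_inj n n0) ?P0 // ltnn.
Qed.

(** The doubled exponent is even, which removes the sign of [u]. *)
Lemma fermat_int p (u : int) : prime p -> ~~ (p%:Z %| u)%Z ->
  (p%:Z %| u ^+ (p.-1).*2 - 1)%Z.
Proof.
move=> p_pr pu.
have -> : u ^+ (p.-1).*2 = (`|u| ^ (p.-1).*2)%N%:Z.
  by rewrite -abszX gez0_abs // exprn_even_ge0 // odd_double.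
have cop : coprime `|u| p by rewrite coprime_sym prime_coprime //; move: pu; rewrite dvdzE.
have := Euler_exp_totient cop; rewrite totient_prime // => E.
rewrite -eqz_mod_dvd; apply/eqP; rewrite -[1]/(1%:Z) !modz_nat -mul2n mulnC expnM.
by rewrite -modnXm E modnXm exp1n.
Qed.

Section Limit.
Variables (L : nat -> seq {poly int}) (st : nat -> state).
Hypothesis G : forall k, good (L k) (st k).
Hypothesis Lsub : forall k, {subset L k <= L k.+1}.
Hypothesis Lext : forall k, extends (L k) (st k) (st k.+1).
Hypothesis srv : forall x : request, exists k, served x (L k) (st k).

Lemma chain_extends j k : (j <= k)%N -> {subset L j <= L k} /\ extends (L j) (st j) (st k).
Proof.
elim: k => [|k IHk]; first by rewrite leqn0 => /eqP->; split=> //; apply: extends_refl.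
rewrite leq_eqVlt => /orP[/eqP->|/IHk[Ljk Ejk]]; first by split=> //; apply: extends_refl.
split=> [g /Ljk/Lsub//|]; apply: extends_trans Ljk _ Ejk (Lext k).
exact: st_ee (good_valid (G k)).
Qed.

Lemma np_unbounded n : exists k, (n < np (st k))%N.
Proof.
have [k [+ _]] := srv (inr (nseq n.+1 (ord0, 0%N))).
by rewrite size_nseq; exists k.
Qed.

Lemma np_mono j k : (j <= k)%N -> (np (st j) <= np (st k))%N.
Proof. by move=> /chain_extends[_ /ext_np]. Qed.

Definition limit_prime n : nat :=
  pp (st (proj1_sig (constructive_indefinite_description _ (np_unbounded n)))) n.
Local Notation P := limit_prime.

Lemma pp_limit k n : (n < np (st k))%N -> pp (st k) n = P n.
Proof.
rewrite /limit_prime; case: constructive_indefinite_description => j /= nj nk.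
by case/orP: (leq_total j k) => /chain_extends[_ E]; rewrite (ext_pp E).
Qed.

Lemma limit_primeP n : prime (P n).
Proof. by have [k nk] := np_unbounded n;
  rewrite -(pp_limit nk) (st_prime (good_valid (G k))). Qed.

Lemma limit_prime_inj : injective P.
Proof.
move=> m n PE; apply/eqP/negPn/negP => mn.
have [k mnk] := np_unbounded (maxn m n).
have mk : (m < np (st k))%N by apply: leq_ltn_trans mnk; apply: leq_maxl.
have nk : (n < np (st k))%N by apply: leq_ltn_trans mnk; apply: leq_maxr.
by have := st_neq (good_valid (G k)) mk nk mn; rewrite !pp_limit // PE eqxx.
Qed.

Definition eventually (Q : nat -> Prop) := exists k0, forall k, (k0 <= k)%N -> Q k.

Lemma eventuallyI Q1 Q2 : eventually Q1 -> eventually Q2 -> eventually (fun k =>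
  Q1 k /\ Q2 k).
Proof.
move=> [k1 H1] [k2 H2]; exists (maxn k1 k2) => k; rewrite geq_max => /andP[kk1 kk2].
by split; [apply: H1 | apply: H2].
Qed.

(** This is the valuation of [f] at the [p]-adic limit of the [al (st k) n i], read off from the
    approximations without constructing the limit. *)
Definition decided n i (f : {poly int}) m :=
  eventually (fun k => f.[al (st k) n i] != 0 /\ vp (P n) f.[al (st k) n i] = m).

Lemma decided_inj n i f m m' : decided n i f m -> decided n i f m' -> m = m'.
Proof.
by move=> D D'; have [k /(_ k (leqnn k))[[_ <-] [_ <-]]] := eventuallyI D D'.
Qed.

Lemma decidedM n i f g m m' : decided n i f m -> decided n i g m' ->
  decided n i (f * g) (m + m').
Proof.
move=> D D'; have [k0 H] := eventuallyI D D'; exists k0 => k /H[[f0 <-] [g0 <-]].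
by rewrite hornerM mulf_neq0 // vpM.
Qed.

Lemma decided_factor n i f g m m' : decided n i (f * g) m -> decided n i f m' ->
  decided n i g (m - m').
Proof.
move=> D D'; have [k0 H] := eventuallyI D D'; exists k0 => k /H[[+ <-] [f0 <-]].
rewrite hornerM mulf_eq0 negb_or => /andP[_ g0]; split=> //.
by rewrite vpM // addKn.
Qed.

Lemma decidedC n i c : c != 0 -> decided n i c%:P (vp (P n) c).
Proof. by move=> c0; exists 0%N => k _; rewrite hornerC. Qed.

(** The degree vanishes at every bound from [N0] on, so that two divisors can be compared at a
    common bound. *)
Definition divisor_of (f : {poly int}) (w : nat -> 'I_4 -> nat) :=
  [/\ forall n i, decided n i f (w n i)
   & exists N0, forall N, (N0 <= N)%N ->
       (forall i, w N i = 0%N) /\ \sum_(n < N) \sum_i wt i * (w n i)%:Z = 0].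

(** Strong induction on the size. Constants have degree 0 because the weights sum to 0, irreducibles
    are served up to a constant, and reducible polynomials split into smaller factors. *)
Lemma divisor_of_neq0 : forall f, f != 0 -> exists w, divisor_of f w.
Proof.
have final N0 (w : nat -> 'I_4 -> nat) : (forall n, (N0 <= n)%N -> forall i, w n i = 0%N) ->
    \sum_(n < N0) \sum_i wt i * (w n i)%:Z = 0 -> forall N, (N0 <= N)%N ->
    (forall i, w N i = 0%N) /\ \sum_(n < N) \sum_i wt i * (w n i)%:Z = 0.
  move=> w0 sum0 N N0N; split; first exact: w0.
  rewrite -(big_mkord xpredT (fun n => \sum_i wt i * (w n i)%:Z)) (big_cat_nat _ N0N) //=.
  rewrite big_mkord sum0 add0r big_nat big1 // => n /andP[/w0 wn _].
  by rewrite big1 // => i _; rewrite wn mulr0.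
have constant c : c != 0 -> exists w, divisor_of c%:P w.
  move=> c0; exists (fun n _ => vp (P n) c); split=> [n i|]; first exact: decidedC.
  have [N NP] := injective_unbounded `|c| limit_prime_inj; exists N.
  apply: final => [n /NP ltP i|].
    by apply: vp_eq0 (limit_primeP n) _; apply: dvdz_lt.
  by rewrite big1 // => n _; apply: sum_wt.
have factor f g w1 w2 : divisor_of (f * g) w1 -> divisor_of f w2 ->
  exists w, divisor_of g w.
  move=> [D1 [N1 H1]] [D2 [N2 H2]]; exists (fun n i => w1 n i - w2 n i)%N.
  have w12 n i : (w2 n i <= w1 n i)%N.
    have [k0 /(_ k0 (leqnn _))[[+ <-] [f0 <-]]] := eventuallyI (D1 n i) (D2 n i).
    rewrite hornerM mulf_eq0 negb_or => /andP[_ g0]; rewrite vpM // leq_addr //.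
  split=> [n i|]; first exact: decided_factor (D1 n i) (D2 n i).
  exists (maxn N1 N2) => N; rewrite geq_max => /andP[/H1[w10 s1] /H2[w20 s2]].
  split=> [i|]; first by rewrite w10.
  transitivity ((\sum_(n < N) \sum_i wt i * (w1 n i)%:Z) - (\sum_(n < N) \sum_i wt i *
    (w2 n i)%:Z));
    last by rewrite s1 s2 subrr.
  rewrite -sumrB; apply: eq_bigr => n _.
  rewrite -sumrB; apply: eq_bigr => i _; rewrite -mulrBr; congr (_ * _).
  by have := w12 n i; lia.
have product f g w1 w2 : divisor_of f w1 -> divisor_of g w2 ->
    divisor_of (f * g) (fun n i => w1 n i + w2 n i)%N.
  move=> [D1 [N1 H1]] [D2 [N2 H2]]; split=> [n i|]; first exact: decidedM.
  exists (maxn N1 N2) => N; rewrite geq_max => /andP[/H1[w10 s1] /H2[w20 s2]].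
  split=> [i|]; first by rewrite w10 w20.
  transitivity ((\sum_(n < N) \sum_i wt i * (w1 n i)%:Z) + (\sum_(n < N) \sum_i wt i *
    (w2 n i)%:Z));
    last by rewrite s1 s2 addr0.
  rewrite -big_split; apply: eq_bigr => n _.
  rewrite -big_split; apply: eq_bigr => i _; by rewrite /= -mulrDr PoszD.
have scaled f c w : c != 0 -> divisor_of (c *: f) w -> exists w', divisor_of f w'.
  move=> c0 D; have [wc Dc] := constant c c0.
  by apply: factor Dc; rewrite mul_polyC; apply: D.
move=> f; have [n] := ubnP (size f); elim: n => // n IHn in f *; rewrite ltnS => fn f0.
have [/size_poly1P[c c0 ->]|f1] := boolP (size f == 1%N); first exact: constant.
have f_gt1 : (1 < size f)%N.
  by move: f1; rewrite -size_poly_gt0 in f0; case: (size f) f0 => [|[]].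
have [f_irr|f_red] := classic (irreducible_poly f).
  have [k /(_ f_irr)[g gL /Pdiv.Idomain.eqpP[[c d] /= /andP[c0 d0] cfdg]]] := srv (inl f).
  suff [w D] : exists w, divisor_of g w.
    have [wd Dd] := constant d d0.
    by apply: (scaled f c _ c0); rewrite cfdg -mul_polyC; apply: product Dd D.
  (* The primes added after stage [k] avoid [g]. *)
  pose w n i := if (n < np (st k))%N then vp (P n) g.[al (st k) n i] else 0%N.
  exists w; split=> [m i|].
    have [j mj] := np_unbounded m; exists (maxn k j) => l; rewrite geq_max => /andP[kl jl].
    have [Lkl Ekl] := chain_extends kl; have ml := leq_trans mj (np_mono jl).
    split; last first.
      rewrite /w; case: ltnP => mk.
        have [_] := extends_vp (good_valid (G k)) Ekl i gL mk.
        by rewrite (ext_pp Ekl) // pp_limit.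
      by rewrite -(pp_limit ml) (extends_vp_new (good_valid (G l)) Ekl i gL) // mk.
    apply: contraTneq (st_frozen (good_valid (G l)) i (Lkl _ gL) ml) => ->.
    by rewrite dvdz0.
  exists (np (st k)); apply: final => [m mk i|].
    by rewrite /w ltnNge mk.
  rewrite -[RHS](good_defect (G k) gL); apply: eq_bigr => m _; apply: eq_bigr => i _.
  by rewrite /w ltn_ord pp_limit.
have [q [q1 qf nqf]] : exists q : {poly int}, [/\ size q != 1%N, q %| f & ~~ (q %= f)].
  apply: NNPP => noq; apply: f_red; split=> // q q1 qf; apply/negPn/negP => nqf.
  by apply: noq; exists q.
have /Pdiv.WeakIdomain.dvdpP[[c r] /= c0 cfrq] := qf.
have q0 : q != 0 by apply: contraNneq f0 => q0; rewrite q0 Pdiv.Idomain.dvd0p in qf.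
have r0 : r != 0.
  apply: contraNneq f0 => r0; move/eqP: cfrq; rewrite r0 mul0r.
  by rewrite -mul_polyC mulf_eq0 polyC_eq0 (negPf c0).
have sq : (size q < size f)%N.
  by rewrite ltn_neqAle Pdiv.Idomain.dvdp_size_eqp // nqf dvdp_leq.
have sr : (size r < size f)%N.
  rewrite -(size_scale f c0) cfrq size_mul //; move: q0 q1; rewrite -size_poly_gt0.
  by case: (size q) => [|[|m]] // _ _; rewrite !addnS /= ltnS leq_addr.
have [||wq Dq] := IHn q; rewrite ?(leq_trans sq) //.
have [||wr Dr] := IHn r; rewrite ?(leq_trans sr) //.
by apply: (scaled f c _ c0); rewrite cfrq; apply: product Dr Dq.
Qed.

(** * Valuations on the fraction field *)

Local Notation K := {fraction {poly int}}.
Local Notation place := (nat * 'I_4)%type.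
Local Notation "a // b" := (FracField.tofrac a / FracField.tofrac b : K) (at level 40).

Definition pval (i : place) f : nat := epsilon (inhabits 0%N) (decided i.1 i.2 f).

Lemma pval_decided i f : f != 0 -> decided i.1 i.2 f (pval i f).
Proof.
move=> /divisor_of_neq0[w [D _]]; apply: epsilon_spec.
by exists (w i.1 i.2).
Qed.

Lemma pvalE i f m : f != 0 -> decided i.1 i.2 f m -> pval i f = m.
Proof. by move=> f0; apply: decided_inj (pval_decided i f0). Qed.

Lemma pvalM i f g : f != 0 -> g != 0 -> pval i (f * g) = (pval i f + pval i g)%N.
Proof.
by move=> f0 g0; apply: pvalE; [rewrite mulf_neq0 | apply: decidedM; apply: pval_decided].
Qed.

Lemma pval_dvd i f m : f != 0 ->
  (m <= pval i f)%N <-> eventually (fun k => ((P i.1)%:Z ^+ m %| f.[al (st k) i.1 i.2])%Z).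
Proof.
move=> f0; have D := pval_decided i f0; have p_pr := limit_primeP i.1.
split=> [mf|Dm].
  have [k0 H] := D; exists k0 => k /H[fk vk].
  by rewrite vp_dvd // vk.
have [k /(_ k (leqnn k))[[fk <-]]] := eventuallyI D Dm.
by rewrite vp_dvd.
Qed.

Lemma pvalD i m f g : f != 0 -> g != 0 -> f + g != 0 ->
  (m <= pval i f)%N -> (m <= pval i g)%N -> (m <= pval i (f + g))%N.
Proof.
move=> f0 g0 fg0 /(pval_dvd i m f0) Df /(pval_dvd i m g0) Dg; apply/pval_dvd => //.
have [k0 H] := eventuallyI Df Dg; exists k0 => k /H[fk gk].
by rewrite hornerD rpredD.
Qed.

Lemma pvalX i f n : f != 0 -> pval i (f ^+ n) = (n * pval i f)%N.
Proof.
move=> f0; elim: n => [|n IHn]; last by rewrite exprS pvalM ?expf_neq0 // IHn mulSn.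
have := @pvalM i 1 1 (oner_neq0 _) (oner_neq0 _); rewrite mulr1 expr0 mul0n; lia.
Qed.

(** An arbitrary representation; [fvalE] shows that the valuation does not depend on it. *)
Definition num_den (x : K) : {poly int} * {poly int} :=
  epsilon (inhabits (0, 1)) (fun ab => ab.2 != 0 /\ x = ab.1 // ab.2).

Definition fval (i : place) (x : K) : int :=
  (pval i (num_den x).1)%:Z - (pval i (num_den x).2)%:Z.

Lemma tofrac_neq0 (a : {poly int}) : a != 0 -> FracField.tofrac a != 0.
Proof. by rewrite tofrac_eq0. Qed.

Lemma fvalE i a b : a != 0 -> b != 0 -> fval i (a // b) = (pval i a)%:Z - (pval i b)%:Z.
Proof.
move=> a0 b0; rewrite /fval; set x := a // b.
have [d0 xE] : (num_den x).2 != 0 /\ x = (num_den x).1 // (num_den x).2.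
  apply: (epsilon_spec (inhabits (0, 1)) (fun ab => ab.2 != 0 /\ x = ab.1 // ab.2)).
  by exists (a, b).
move: (num_den x) d0 xE => [c d] /= d0 xE.
have E : a * d = c * b.
  apply/eqP; rewrite -(@tofrac_eq _ (a * d)) !tofracM.
  by rewrite -eqr_div ?tofrac_neq0 // -/x xE.
have c0 : c != 0.
  by apply: contraNneq (mulf_neq0 a0 d0) => c0; rewrite E c0 mul0r.
by have := congr1 (pval i) E; rewrite !pvalM //; lia.
Qed.

Lemma fraction_neq0 (x : K) : x != 0 ->
  exists a b, [/\ a != 0, b != 0 & x = a // b].
Proof.
have [a [b [b0 ->]]] := fraction_div x; move=> x0; exists a, b; split=> //.
by apply: contraNneq x0 => ->; rewrite tofrac0 mul0r.
Qed.

Lemma fval_ge_poly i m f g : f != 0 -> g != 0 ->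
  val_ge fval i m (f // g) = (m <= (pval i f)%:Z - (pval i g)%:Z).
Proof.
by move=> f0 g0; rewrite /val_ge fvalE // mulf_eq0 invr_eq0 !tofrac_eq0 (negPf f0) (negPf
  g0).
Qed.

Lemma fvalM i x y : x != 0 -> y != 0 -> fval i (x * y) = fval i x + fval i y.
Proof.
move=> /fraction_neq0[a [b [a0 b0 ->]]] /fraction_neq0[c [d [c0 d0 ->]]].
rewrite mulf_div -!tofracM !fvalE ?mulf_neq0 // !pvalM //; lia.
Qed.

Lemma fvalD i m x y : val_ge fval i m x -> val_ge fval i m y -> val_ge fval i m (x + y).
Proof.
have [->|] := eqVneq x 0; first by rewrite add0r.
have [->|] := eqVneq y 0; first by rewrite addr0.
move=> /fraction_neq0[a [b [a0 b0 ->]]] /fraction_neq0[c [d [c0 d0 ->]]].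
rewrite addf_div ?tofrac_neq0 // -!tofracM -tofracD.
have [s0|s0] := eqVneq (c * b + a * d) 0; first by rewrite s0 tofrac0 mul0r /val_ge eqxx.
rewrite !fval_ge_poly ?mulf_neq0 // => mc ma.
(* This is the order the new numerator must reach; if it is not positive, the natural number [pval]
   reaches it trivially. *)
set t := m + (pval i d)%:Z + (pval i b)%:Z.
have [t0|t0] := leP t 0.
  by rewrite pvalM //; move: t0; rewrite /t; lia.
have : (absz t <= pval i (c * b + a * d))%N.
  by apply: pvalD; rewrite ?mulf_neq0 // pvalM //; move: t0; rewrite /t; lia.
rewrite pvalM // PoszD; move: t0; rewrite /t.
move: (pval i d) (pval i b) (pval i (c * b + a * d)) => k l z; lia.
Qed.

(** At late approximations the numerator and denominator are integers prime to [p] times the same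
    power of [p], and Fermat applies to these two integers. *)
Lemma fval_residue i x : x != 0 -> fval i x = 0 ->
  exists n, val_ge fval i 1 (x ^+ n.+1 - 1).
Proof.
move=> /fraction_neq0[a [b [a0 b0 ->]]]; rewrite fvalE // => /eqP.
rewrite subr_eq0 => /eqP[ab]; set p := P i.1; have p_pr : prime p := limit_primeP i.1.
have nE : (p.-1).*2 = ((p.-1).*2.-1).+1 by rewrite prednK // double_gt0 -subn1 subn_gt0
  prime_gt1.
exists (p.-1).*2.-1; rewrite -nE; set n := (p.-1).*2.
have E : (a // b) ^+ n - 1 = (a ^+ n - b ^+ n) // (b ^+ n).
  by rewrite expr_div_n tofracB !tofracXn mulrBl mulfV // expf_neq0 ?tofrac_neq0.
rewrite E; have [->|h0] := eqVneq (a ^+ n - b ^+ n) 0;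
  first by rewrite tofrac0 mul0r /val_ge eqxx.
rewrite fval_ge_poly ?expf_neq0 // pvalX // -ab.
suff : ((n * pval i a).+1 <= pval i (a ^+ n - b ^+ n))%N by lia.
apply/pval_dvd => //; have [k0 H] := eventuallyI (pval_decided i a0) (pval_decided i b0).
exists k0 => k /H[[ak va] [bk vb]]; rewrite -/p in va vb *.
rewrite hornerD hornerN !horner_exp.
have unitpart z m : z != 0 -> vp p z = m -> exists2 u, z = u * p%:Z ^+ m & ~~ (p%:Z %| u)%Z.
  move=> z0 zm; have /dvdzP[u zu] : (p%:Z ^+ m %| z)%Z by rewrite vp_dvd // zm.
  exists u => //; apply/negP => /dvdzP[w uw].
  have : (p%:Z ^+ m.+1 %| z)%Z by rewrite zu uw -mulrA -exprS dvdz_mull.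
  by rewrite vp_dvd // zm ltnn.
have [u -> pu] := unitpart _ _ ak va; have [w -> pw] := unitpart _ _ bk vb.
rewrite -ab !exprMn -!exprM -mulrBl [(pval i a * n)%N]mulnC exprS; apply: dvdz_mul => //.
have -> : u ^+ n - w ^+ n = (u ^+ n - 1) - (w ^+ n - 1) by ring.
by apply: rpredB; apply: fermat_int.
Qed.

Definition fclass (i : place) : int := wt i.2.

Lemma fval_support x : x != 0 -> exists N0, forall N, (N0 <= N)%N ->
  (forall i, fval (N, i) x = 0) /\ \sum_(n < N) \sum_i wt i * fval (n : nat, i) x = 0.
Proof.
move=> /fraction_neq0[a [b [a0 b0 ->]]].
have [w1 [D1 [N1 H1]]] := divisor_of_neq0 a0; have [w2 [D2 [N2 H2]]] := divisor_of_neq0 b0.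
have vE n i : fval (n : nat, i) (a // b) = (w1 n i)%:Z - (w2 n i)%:Z.
  by rewrite fvalE //; congr (_%:Z - _%:Z); apply: pvalE => //=.
exists (maxn N1 N2) => N; rewrite geq_max => /andP[/H1[w10 s1] /H2[w20 s2]].
split=> [i|]; first by rewrite vE w10 w20.
transitivity ((\sum_(n < N) \sum_i wt i * (w1 n i)%:Z) - (\sum_(n < N) \sum_i wt i * (w2
  n i)%:Z));
  last by rewrite s1 s2 subrr.
rewrite -sumrB; apply: eq_bigr => n _; rewrite -sumrB; apply: eq_bigr => i _.
by rewrite vE mulrBr.
Qed.

Lemma fval_degree0 x : x != 0 -> exists S : seq place, [/\ uniq S,
  (forall i, i \notin S -> fval i x = 0) & \sum_(i <- S) fclass i * fval i x = 0].
Proof.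
move=> /fval_support[N H]; pose S := [seq (n, i) | n <- iota 0 N, i <- enum 'I_4].
exists S; split.
- by apply: allpairs_uniq; rewrite ?iota_uniq ?enum_uniq // => -[? ?] [? ?] _ _ [-> ->].
- move=> [n i] nS; suff /H[v0 _] : (N <= n)%N by apply: v0.
  rewrite leqNgt; apply: contra nS => nN; apply/allpairsP; exists (n, i).
  by rewrite mem_iota mem_enum.
- have -> : S = [seq (n, i) | n <- index_iota 0 N,
  i <- enum 'I_4] by rewrite /index_iota subn0.
  rewrite big_allpairs big_mkord.
  have [_ sum0] := H N (leqnn N); apply: etrans sum0; apply: eq_bigr => n _.
  by rewrite big_enum.
Qed.

(** * Principal divisors *)

Definition is_divisor (d : place -> int) :=
  exists2 x : K, x != 0 & forall i, fval i x = d i.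

Lemma is_divisorD d d' : is_divisor d -> is_divisor d' -> is_divisor (fun i => d i + d' i).
Proof.
move=> [x x0 xd] [y y0 yd]; exists (x * y) => [|i].
  exact: (@mulf_neq0 K x y x0 y0).
by rewrite (fvalM i x0 y0) xd yd.
Qed.

Lemma is_divisor0 : is_divisor (fun=> 0).
Proof.
exists (1 // 1) => [|i]; last by rewrite fvalE ?oner_neq0 // subrr.
by rewrite tofrac1 divr1 oner_neq0.
Qed.

Lemma is_divisorN d : is_divisor d -> is_divisor (fun i => - d i).
Proof.
move=> [x /fraction_neq0[a [b [a0 b0 ->]]] xd]; exists (b // a) => [|i].
  by rewrite mulf_eq0 invr_eq0 !tofrac_eq0 negb_or b0.
by rewrite -xd !fvalE // opprB.
Qed.

Lemma is_divisorZ d (k : int) : is_divisor d -> is_divisor (fun i => k * d i).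
Proof.
move=> Dd; have nat_case (m : nat) : is_divisor (fun i => m%:Z * d i).
  elim: m => [|m IHm].
    by have [x x0 xd] := is_divisor0; exists x => // i; rewrite xd mul0r.
  have [x x0 xd] := is_divisorD Dd IHm; exists x => // i.
  by rewrite xd intS mulrDl mul1r.
case: (intP k) => [|m|m]; [exact: (nat_case 0%N) | exact: (nat_case m.+1) |].
have [x x0 xd] := is_divisorN (nat_case m.+1); exists x => // i.
by rewrite xd mulNr.
Qed.

Lemma is_divisor_ext d d' : d =1 d' -> is_divisor d -> is_divisor d'.
Proof. by move=> dd [x x0 xd]; exists x => // i; rewrite xd dd. Qed.

Lemma is_divisor_target s : target_degree s (size s) = 0 ->
  is_divisor (fun i => (target_at s i.1 i.2)%:Z).
Proof.
move=> s0; have [k [sk /(_ s0)[b bL vb]]] := srv (inr s).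
exists (('X - b%:P) // 1) => [|[n i]].
  by rewrite mulf_eq0 invr_eq0 !tofrac_eq0 polyXsubC_eq0 oner_eq0.
have X0 : 'X - b%:P != 0 :> {poly int} by rewrite polyXsubC_eq0.
rewrite fvalE ?oner_neq0 //.
have -> : pval (n, i) 1 = 0%N.
  apply: pvalE; first exact: oner_neq0.
  by exists 0%N => l _; rewrite hornerC /vp logn1.
rewrite subr0 /=; congr (_%:Z); apply: pvalE => //=.
have [j nj] := np_unbounded n; exists (maxn k j) => l; rewrite geq_max => /andP[kl jl].
have [Lkl Ekl] := chain_extends kl; have nl := leq_trans nj (np_mono jl).
split.
  apply: contraTneq (st_frozen (good_valid (G l)) i (Lkl _ bL) nl) => ->.
  by rewrite dvdz0.
have [nk|nk] := ltnP n (np (st k)).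
  have [_] := extends_vp (good_valid (G k)) Ekl i bL nk.
  by rewrite (ext_pp Ekl) // pp_limit // => ->; rewrite hornerXsubC -(pp_limit nk) vb.
rewrite -(pp_limit nl) (extends_vp_new (good_valid (G l)) Ekl i bL) ?nk //.
by rewrite /target_at /target nth_default ?if_same //; apply: leq_trans nk.
Qed.

Definition unit_at (i j : place) : int := (j == i)%:Z.

(** The primes must differ because a target prescribes a single place at each prime. *)
Lemma is_divisor_pair n n' i i' m m' : n != n' -> wt i * m%:Z + wt i' * m'%:Z = 0 ->
  is_divisor (fun j => m%:Z * unit_at (n, i) j + m'%:Z * unit_at (n', i') j).
Proof.
move=> nn' deg.
pose t k := if k == n then (i, m) else if k == n' then (i', m') else (ord0, 0%N).
pose s := mkseq t (maxn n n').+1.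
have sE k : target s k = t k.
  rewrite /target; have [lt_k|le_k] := ltnP k (maxn n n').+1; first by rewrite nth_mkseq.
  rewrite nth_default ?size_mkseq // /t; move: le_k; rewrite gtn_max => /andP[nk n'k].
  by rewrite gtn_eqF // gtn_eqF.
apply: (@is_divisor_ext (fun j => (target_at s j.1 j.2)%:Z)) => [[k j]|].
  rewrite /= /target_at sE /t /unit_at !xpair_eqE.
  have [->|kn] := eqVneq k n; first by rewrite (negPf nn') /=; case: eqP; lia.
  by case: (eqVneq k n') => _ /=; case: eqP; lia.
apply: is_divisor_target; rewrite /target_degree size_mkseq.
have nM : (n < (maxn n n').+1)%N by rewrite ltnS leq_maxl.
have n'M : (n' < (maxn n n').+1)%N by rewrite ltnS leq_maxr.
rewrite (bigD1 (Ordinal nM)) //= (bigD1 (Ordinal n'M)) /=;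
  last by rewrite -val_eqE /= eq_sym.
rewrite !sE /t eqxx eq_sym (negPf nn') eqxx /= big1 ?addr0 // => k.
by rewrite -!val_eqE /= => /andP[/negPf kn /negPf kn']; rewrite sE /t kn kn' mulr0.
Qed.

Lemma is_divisor_three n n' n'' : uniq [:: n; n'; n''] ->
  is_divisor (fun j => unit_at (n, ord0) j + (unit_at (n', inord 2) j + unit_at (n'',
    inord 2) j)).
Proof.
rewrite /= !inE negb_or andbT => /andP[/andP[nn' nn''] n'n''].
pose t k := if k == n then (ord0, 1%N) else if k == n' then (inord 2 : 'I_4, 1%N)
  else if k == n'' then (inord 2, 1%N) else (ord0, 0%N).
pose M := (maxn n (maxn n' n'')).+1; pose s := mkseq t M.
have sE k : target s k = t k.
  rewrite /target; have [lt_k|le_k] := ltnP k M; first by rewrite nth_mkseq.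
  rewrite nth_default ?size_mkseq // /t; move: le_k;
    rewrite /M !gtn_max => /and3P[nk n'k n''k].
  by rewrite !gtn_eqF.
apply: (@is_divisor_ext (fun j => (target_at s j.1 j.2)%:Z)) => [[k j]|].
  rewrite /= /target_at sE /t /unit_at !xpair_eqE.
  have [->|kn] := eqVneq k n; first by rewrite (negPf nn') (negPf nn'') /=; case: eqP.
  have [->|kn'] /= := eqVneq k n'; first by rewrite (negPf n'n'') /=; case: eqP.
  by case: (eqVneq k n'') => _ /=; case: eqP.
apply: is_divisor_target; rewrite /target_degree size_mkseq.
have nM : (n < M)%N by rewrite ltnS leq_maxl.
have n'M : (n' < M)%N by rewrite ltnS leq_max leq_maxl orbT.
have n''M : (n'' < M)%N by rewrite ltnS leq_max leq_maxr orbT.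
rewrite (bigD1 (Ordinal nM)) //= (bigD1 (Ordinal n'M)) /=;
  last by rewrite -val_eqE /= eq_sym.
rewrite (bigD1 (Ordinal n''M)) /=;
  last by rewrite -!val_eqE /= ![n'' == _]eq_sym nn'' n'n''.
rewrite !sE /t !eqxx [n' == n]eq_sym [n'' == n]eq_sym [n'' == n']eq_sym.
rewrite (negPf nn') (negPf nn'') (negPf n'n'') /= big1 ?addr0 => [|k];
  first by rewrite /wt inordK.
by rewrite -!val_eqE /= -andbA => /and3P[/negPf kn /negPf kn' /negPf kn''];
  rewrite sE /t kn kn' kn'' mulr0.
Qed.

(** Targets give only effective divisors, so the difference comes from subtracting two relations
    that share a place of class 2 at an auxiliary prime [k]. *)
Lemma is_divisor_opp1 n n' :
  is_divisor (fun j => unit_at (n, inord 2) j - unit_at (n', inord 2) j).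
Proof.
have [->|nn'] := eqVneq n n'.
  by apply: is_divisor_ext is_divisor0 => j; rewrite subrr.
pose k := (n + n').+1; have kn : k != n by rewrite /k; lia.
have kn' : k != n' by rewrite /k; lia.
have D1 : is_divisor (fun j =>
  unit_at (k, ord0) j + (unit_at (n, inord 2) j + unit_at (n', inord 2) j)).
  by apply: is_divisor_three; rewrite /= !inE negb_or kn kn' nn'.
have D2 : is_divisor (fun j =>
  1%N%:Z * unit_at (k, ord0) j + 2%N%:Z * unit_at (n', inord 2) j).
  by apply: is_divisor_pair => //; rewrite /wt inordK.
apply: is_divisor_ext (is_divisorD D1 (is_divisorN D2)) => j; ring.
Qed.

Definition base_place : place := (0%N, inord 2).

(** The class of every place is a multiple of that of [base_place]: a relation with some place of
    class -1 comes first, and [is_divisor_opp1] moves it to the base. *)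
Lemma is_divisor_unit i :
  is_divisor (fun j => unit_at i j + fclass i * unit_at base_place j).
Proof.
case: i => n i; rewrite /fclass /=.
suff [n' D] : exists n', is_divisor (fun j =>
  unit_at (n, i) j + wt i * unit_at (n', inord 2) j).
  apply: is_divisor_ext (is_divisorD D (is_divisorZ (wt i) (is_divisor_opp1 0 n'))) => j.
  by rewrite /base_place; ring.
have n1 : n != n.+1 by rewrite ltn_eqF.
have [wi|wi] := ltP 0 (wt i).
  exists n.+1; have [|x x0 xd] := @is_divisor_pair n n.+1 i (inord 2) 1 (absz (wt i)) n1.
    have -> : wt (inord 2) = -1 by rewrite /wt inordK.
    by rewrite gtz0_abs //; ring.
  by exists x => // j; rewrite xd gtz0_abs // mul1r.
have : i = inord 2 \/ i = inord 3.
  have iE : i = inord (val i) by rewrite inord_val.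
  by rewrite iE; case: i wi {iE} => -[|[|[|[|]]]] //= _ _; [left | right].
case=> ->.
  by exists n; apply: is_divisor_ext is_divisor0 => j; rewrite /wt inordK //=; ring.
(* Classes -4 and -1 have the same sign and admit no effective relation; a place of class 2 is
   introduced and then eliminated. *)
exists n; have n1' : n.+1 != n by rewrite gtn_eqF.
have D1 : is_divisor (fun j =>
  1%N%:Z * unit_at (n, inord 3) j + 2%N%:Z * unit_at (n.+1, ord0) j).
  by apply: is_divisor_pair => //; rewrite /wt inordK.
have D2 : is_divisor (fun j =>
  1%N%:Z * unit_at (n.+1, ord0) j + 2%N%:Z * unit_at (n, inord 2) j).
  by apply: is_divisor_pair => //; rewrite /wt inordK.
apply: is_divisor_ext (is_divisorD D1 (is_divisorZ (-2) D2)) => j.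
by rewrite /wt inordK //=; ring.
Qed.

(** In the combination of the relations of [is_divisor_unit] with coefficients [n], the base place
    is multiplied by the degree, which is 0. *)
Lemma fval_principal (S : seq place) n : uniq S -> \sum_(i <- S) fclass i * n i = 0 ->
  exists2 x : K, x != 0 & forall i, fval i x = if i \in S then n i else 0.
Proof.
move=> uS deg0.
have step (T : seq place) : is_divisor (fun j =>
    \sum_(i <- T) n i * unit_at i j + (\sum_(i <- T) fclass i * n i) * unit_at base_place
      j).
  elim: T => [|i T IHT].
    by apply: is_divisor_ext is_divisor0 => j; rewrite !big_nil mul0r addr0.
  apply: is_divisor_ext (is_divisorD (is_divisorZ (n i) (is_divisor_unit i)) IHT) => j.
  by rewrite !big_cons; ring.
have [x x0 xd] := step S; exists x => // j; rewrite xd deg0 mul0r addr0.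
have [jS|jS] := boolP (j \in S).
  rewrite (bigD1_seq j) //= /unit_at eqxx mulr1 big1 ?addr0 // => i ij.
  by rewrite eq_sym (negPf ij) mulr0.
rewrite big1_seq // => i /andP[_ iS]; rewrite /unit_at; case: eqP => [ji|];
  last by rewrite mulr0.
by rewrite ji iS in jS.
Qed.

Lemma place_notin (S : seq place) (i : 'I_4) : exists n, (n, i) \notin S.
Proof.
exists (\sum_(j <- S) j.1).+1; apply/negP => nS.
suff : ((\sum_(j <- S) j.1).+1 <= \sum_(j <- S) j.1)%N by rewrite ltnn.
by rewrite [leqRHS](big_rem _ nS) /= leq_addr.
Qed.

Lemma limit_divisor_theory : divisor_theory fval fclass.
Proof.
split.
- exact: fvalM.
- exact: fvalD.
- exact: fval_residue.
- exact: fval_degree0.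
- exact: fval_principal.
- by move=> S; have [n nS] := place_notin S ord0; exists (n, ord0).
- by move=> S; have [n nS] := place_notin S (inord 2); exists (n, inord 2);
  rewrite // /fclass /wt inordK.
- by move=> i; apply: wt_neq0.
Qed.

End Limit.

(** * The example *)

Lemma divisor_theory_exists : exists (v : nat * 'I_4 -> {fraction {poly int}} -> int),
  divisor_theory v fclass.
Proof.
have [L [st [G Lsub Lext srv]]] := chain.
by exists (fval srv); apply: limit_divisor_theory.
Qed.

Theorem theorem3p16 :
  (exists (K : fieldType) (A : K -> Prop),
     [/\ is_subring A, is_frac_field A, dedekind A,
         (exists D, [/\ overring A D, well_centered A D & ~ localization_of A D])
       & two_awc_property A]) /\
  (exists (K : fieldType) (A : K -> Prop),
     [/\ is_subring A, is_frac_field A, dedekind A,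
         (exists D, [/\ overring A D, almost_well_centered A D & ~ well_centered A D])
       & two_awc_property A]).
Proof.
have [v dt] := divisor_theory_exists.
have wc := negative_side_well_centered dt.
have awc := side_almost_well_centered dt (or_introl erefl).
have not_loc : ~ localization_of (integer v) (inverting v (side fclass (-1))).
  have [i ei] := side_inhabited dt (or_intror erefl).
  by apply: (one_sided_not_localization dt _ (fun _ h => h) ei).
have not_wc : ~ well_centered (integer v) (inverting v (side fclass 1)).
  apply: (positive_side_not_well_centered dt (i := (0%N, inord 1))).
    by case=> n [[|[|[|[|]]]]].
  by rewrite /fclass /wt inordK.
split; exists _, (integer v); split; try by [exact: (inverting_subring dt) |
  exact: (integer_frac_field dt) | exact: (integer_dedekind dt) | exact: (integer_two_awc
    dt)].
- by exists (inverting v (side fclass (-1))); split=> //; apply: (inverting_overring dt).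
- by exists (inverting v (side fclass 1)); split=> //; apply: (inverting_overring dt).
Qed.
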